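(* Let $R$ and $S$ be commutative associative unitary rings, and let $p:R\rightarrowtail S$ be a monomorphism (injective unital ring homomorphism). Then $p$, regarded as a morphism of ternary rings, is an effective codescent morphism in the category of ternary rings if and only if $p$ satisfies the ring-theoretic ideal extension property: for every ideal $I$ of the ring $R$ there is an ideal $I'$ of the ring $S$ such that $p^{-1}(I')=I$.
   Context: A ternary ring is an algebra with two ternary operations $t,q$ and two constants $0,1$ satisfying $t(0,x,y)=y$, $t(x,0,y)=y$, $t(1,x,0)=x$, $t(x,1,0)=x$, $q(x,y,t(x,y,z))=z$, $t(x,y,q(x,y,z))=z$. Homomorphisms preserve all operations. Every unitary ring is regarded as a ternary ring with the same $0,1$ and $t(a,b,c)=ab+c$ (so $q(a,b,c)=c-ab$); in this way unitary rings form a full subcategory of the category of ternary rings. Codescent: for a category $\mathcal{C}$ with pushouts and a morphism $p:B\to E$, the change-of-cobase functor $p_*:B/\mathcal{C}\to E/\mathcal{C}$ between coslice categories sends $\varphi:B\to C$ to the pushout of $\varphi$ along $p$ (as an object under $E$). It has a right adjoint $p^!:E/\mathcal{C}\to B/\mathcal{C}$, $\psi\mapsto\psi p$. The morphism $p$ is an effective codescent morphism in $\mathcal{C}$ if $p_*$ is comonadic (the comparison functor from $B/\mathcal{C}$ to the category of coalgebras of the comonad $p_*p^!$ on $E/\mathcal{C}$ is an equivalence); equivalently, $p$ is an effective descent morphism in $\mathcal{C}^{\mathrm{op}}$. *)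

(* Defs.v *)
From HB Require Import structures.
From mathcomp Require Import all_boot all_order all_algebra.
From mathcomp Require Import boolp classical_sets.

Set Implicit Arguments.
Unset Strict Implicit.
Unset Printing Implicit Defensive.

Import GRing.Theory.

Local Open Scope quotient_scope.
Local Open Scope ring_scope.

#[local] Obligation Tactic := idtac.

(* Morphisms are compared with Leibniz equality; for the categories below this
   relies on the extensionality axioms of boolp. *)

Record category := Category {
  ob :> Type;
  hom : ob -> ob -> Type;
  idm : forall X, hom X X;
  comp : forall X Y Z, hom Y Z -> hom X Y -> hom X Z;
  compA : forall X Y Z W (h : hom Z W) (g : hom Y Z) (f : hom X Y),
    comp h (comp g f) = comp (comp h g) f;
  comp1m : forall X Y (f : hom X Y), comp (idm Y) f = f;
  compm1 : forall X Y (f : hom X Y), comp f (idm X) = f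
}.
Arguments hom {c} X Y.
Arguments idm {c} X.
Arguments comp {c X Y Z} g f.

Declare Scope cat_scope.
Delimit Scope cat_scope with cat.
Local Open Scope cat_scope.
Notation "g ∘ f" := (comp g f) (at level 40, left associativity) : cat_scope.

Definition is_iso (C : category) (X Y : C) (f : hom X Y) : Prop :=
  exists g : hom Y X, g ∘ f = idm X /\ f ∘ g = idm Y.

Record functor (C D : category) := Functor {
  fob :> C -> D;
  fmap : forall X Y, hom X Y -> hom (fob X) (fob Y);
  fmap_id : forall X, fmap (idm X) = idm (fob X);
  fmap_comp : forall X Y Z (g : hom Y Z) (f : hom X Y),
    fmap (g ∘ f) = fmap g ∘ fmap f
}.
Arguments fmap {C D} _ {X Y} _.

Definition functor_id (C : category) : functor C C :=
  @Functor C C id (fun _ _ f => f) (fun _ => erefl) (fun _ _ _ _ _ => erefl).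

Program Definition functor_comp (C D E : category)
    (G : functor D E) (F : functor C D) : functor C E :=
  @Functor C E (fun X => G (F X)) (fun X Y f => fmap G (fmap F f)) _ _.
Next Obligation. by move=> * /=; rewrite !fmap_id. Qed.
Next Obligation. by move=> * /=; rewrite !fmap_comp. Qed.

Record nat_trans (C D : category) (F G : functor C D) := NatTrans {
  component :> forall X, hom (F X) (G X);
  naturality : forall X Y (f : hom X Y),
    component Y ∘ fmap F f = fmap G f ∘ component X
}.

Definition naturally_isomorphic (C D : category) (F G : functor C D) : Prop :=
  exists a : nat_trans F G, forall X, is_iso (a X).

Definition is_equivalence (C D : category) (F : functor C D) : Prop :=
  exists G : functor D C,
    naturally_isomorphic (functor_id C) (functor_comp G F) /\
    naturally_isomorphic (functor_comp F G) (functor_id D).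

Record adjunction (C D : category) (F : functor C D) (G : functor D C) :=
  Adjunction {
  adj_unit : nat_trans (functor_id C) (functor_comp G F);
  adj_counit : nat_trans (functor_comp F G) (functor_id D);
  adj_triangleL : forall X, adj_counit (F X) ∘ fmap F (adj_unit X) = idm (F X);
  adj_triangleR : forall Y, fmap G (adj_counit Y) ∘ adj_unit (G Y) = idm (G Y)
}.

Record comonad (D : category) := Comonad {
  cmd_functor :> functor D D;
  cmd_counit : nat_trans cmd_functor (functor_id D);
  cmd_comult : nat_trans cmd_functor (functor_comp cmd_functor cmd_functor);
  cmd_counitl : forall X,
    cmd_counit (cmd_functor X) ∘ cmd_comult X = idm (cmd_functor X);
  cmd_counitr : forall X,
    fmap cmd_functor (cmd_counit X) ∘ cmd_comult X = idm (cmd_functor X);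
  cmd_coassoc : forall X,
    cmd_comult (cmd_functor X) ∘ cmd_comult X =
    fmap cmd_functor (cmd_comult X) ∘ cmd_comult X
}.

Section Coalgebras.
Variables (D : category) (W : comonad D).

Record coalgebra := Coalgebra {
  coalg_ob : D;
  coalg_str : hom coalg_ob (W coalg_ob);
  coalg_counit : cmd_counit W coalg_ob ∘ coalg_str = idm coalg_ob;
  coalg_coassoc :
    cmd_comult W coalg_ob ∘ coalg_str = fmap W coalg_str ∘ coalg_str
}.

Record coalgebra_hom (X Y : coalgebra) := CoalgebraHom {
  coalg_map : hom (coalg_ob X) (coalg_ob Y);
  coalg_map_str : coalg_str Y ∘ coalg_map = fmap W coalg_map ∘ coalg_str X
}.

Lemma coalgebra_hom_eq (X Y : coalgebra) (f g : coalgebra_hom X Y) :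
  coalg_map f = coalg_map g -> f = g.
Proof.
case: f g => [f Hf] [g Hg] /= E; subst g; congr CoalgebraHom.
exact: Prop_irrelevance.
Qed.

Program Definition coalgebra_id (X : coalgebra) : coalgebra_hom X X :=
  @CoalgebraHom X X (idm _) _.
Next Obligation. by move=> X; rewrite fmap_id comp1m compm1. Qed.

Program Definition coalgebra_comp (X Y Z : coalgebra)
    (g : coalgebra_hom Y Z) (f : coalgebra_hom X Y) : coalgebra_hom X Z :=
  @CoalgebraHom X Z (coalg_map g ∘ coalg_map f) _.
Next Obligation.
move=> X Y Z g f.
by rewrite fmap_comp compA coalg_map_str -compA coalg_map_str compA.
Qed.

Program Definition coalgebras : category :=
  @Category coalgebra coalgebra_hom coalgebra_id coalgebra_comp _ _ _.
Next Obligation. by move=> *; apply: coalgebra_hom_eq; rewrite /= compA. Qed.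
Next Obligation. by move=> *; apply: coalgebra_hom_eq; rewrite /= comp1m. Qed.
Next Obligation. by move=> *; apply: coalgebra_hom_eq; rewrite /= compm1. Qed.

End Coalgebras.

Section Comonadicity.
Variables (C D : category) (F : functor C D) (G : functor D C).
Variable adj : adjunction F G.

Let FG := functor_comp F G.

Program Definition adj_comult : nat_trans FG (functor_comp FG FG) :=
  @NatTrans D D FG (functor_comp FG FG)
    (fun Y => fmap F (adj_unit adj (G Y))) _.
Next Obligation.
by move=> X Y f; rewrite /= -!fmap_comp (naturality (adj_unit adj)).
Qed.

Program Definition adj_comonad : comonad D :=
  @Comonad D FG (adj_counit adj) adj_comult _ _ _.
Next Obligation. by move=> X; exact: (adj_triangleL adj (G X)). Qed.
Next Obligation.
by move=> X; rewrite /= -fmap_comp adj_triangleR fmap_id.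
Qed.
Next Obligation.
by move=> X; rewrite /= -!fmap_comp (naturality (adj_unit adj)).
Qed.

Program Definition comparison_ob (X : C) : coalgebra adj_comonad :=
  @Coalgebra D adj_comonad (F X) (fmap F (adj_unit adj X)) _ _.
Next Obligation. by move=> X; exact: adj_triangleL. Qed.
Next Obligation.
by move=> X; rewrite /= -!fmap_comp (naturality (adj_unit adj)).
Qed.

Program Definition comparison_map (X Y : C) (f : hom X Y) :
    coalgebra_hom (comparison_ob X) (comparison_ob Y) :=
  @CoalgebraHom _ adj_comonad (comparison_ob X) (comparison_ob Y) (fmap F f) _.
Next Obligation.
by move=> X Y f; rewrite /= -!fmap_comp (naturality (adj_unit adj)).
Qed.

Program Definition comparison : functor C (coalgebras adj_comonad) :=
  @Functor C (coalgebras adj_comonad) comparison_ob comparison_map _ _.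
Next Obligation. by move=> X; apply: coalgebra_hom_eq; rewrite /= fmap_id. Qed.
Next Obligation.
by move=> X Y Z g f; apply: coalgebra_hom_eq; rewrite /= fmap_comp.
Qed.

Definition comonadic : Prop := is_equivalence comparison.

End Comonadicity.

Section Coslice.
Variables (C : category) (B : C).

Record coslice_ob := CosliceOb {
  cs_cod : C;
  cs_arr : hom B cs_cod
}.

Record coslice_hom (X Y : coslice_ob) := CosliceHom {
  cs_map : hom (cs_cod X) (cs_cod Y);
  cs_map_arr : cs_map ∘ cs_arr X = cs_arr Y
}.

Lemma coslice_hom_eq (X Y : coslice_ob) (f g : coslice_hom X Y) :
  cs_map f = cs_map g -> f = g.
Proof.
case: f g => [f Hf] [g Hg] /= E; subst g; congr CosliceHom.
exact: Prop_irrelevance.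
Qed.

Definition coslice_id (X : coslice_ob) : coslice_hom X X :=
  CosliceHom (comp1m (cs_arr X)).

Program Definition coslice_comp (X Y Z : coslice_ob)
    (g : coslice_hom Y Z) (f : coslice_hom X Y) : coslice_hom X Z :=
  @CosliceHom X Z (cs_map g ∘ cs_map f) _.
Next Obligation. by move=> X Y Z g f; rewrite -compA !cs_map_arr. Qed.

Program Definition coslice : category :=
  @Category coslice_ob coslice_hom coslice_id coslice_comp _ _ _.
Next Obligation. by move=> *; apply: coslice_hom_eq; rewrite /= compA. Qed.
Next Obligation. by move=> *; apply: coslice_hom_eq; rewrite /= comp1m. Qed.
Next Obligation. by move=> *; apply: coslice_hom_eq; rewrite /= compm1. Qed.

End Coslice.

(* [po_inr] is the pushout of [f] along [p], [po_inl] that of [p] along [f]. *)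
Record pushout (C : category) (A B E : C) (f : hom B A) (p : hom B E) :=
  Pushout {
  po_ob : C;
  po_inl : hom A po_ob;
  po_inr : hom E po_ob;
  po_comm : po_inl ∘ f = po_inr ∘ p;
  po_univ : forall (X : C) (a : hom A X) (e : hom E X),
    a ∘ f = e ∘ p -> hom po_ob X;
  po_univl : forall X a e (H : a ∘ f = e ∘ p), @po_univ X a e H ∘ po_inl = a;
  po_univr : forall X a e (H : a ∘ f = e ∘ p), @po_univ X a e H ∘ po_inr = e;
  po_uniq : forall X (u v : hom po_ob X),
    u ∘ po_inl = v ∘ po_inl -> u ∘ po_inr = v ∘ po_inr -> u = v
}.
Arguments po_univ {C A B E f p} _ {X a e} _.

Definition pushouts (C : category) : Type :=
  forall (A B E : C) (f : hom B A) (p : hom B E), pushout f p.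

Section ChangeOfCobase.
Variables (C : category) (po : pushouts C) (B E : C) (p : hom B E).

(* p^! *)
Program Definition precomp_functor : functor (coslice E) (coslice B) :=
  @Functor (coslice E) (coslice B)
    (fun Y => CosliceOb (cs_arr Y ∘ p))
    (fun X Y g => @CosliceHom C B (CosliceOb (cs_arr X ∘ p))
                    (CosliceOb (cs_arr Y ∘ p)) (cs_map g) _) _ _.
Next Obligation. by move=> X Y g; rewrite /= compA cs_map_arr. Qed.
Next Obligation. by move=> X; exact: coslice_hom_eq. Qed.
Next Obligation. by move=> X Y Z g f; exact: coslice_hom_eq. Qed.

Let P (X : coslice_ob B) := po (cs_arr X) p.

Lemma cobase_map_comm (X Y : coslice_ob B) (f : coslice_hom X Y) :
  (po_inl (P Y) ∘ cs_map f) ∘ cs_arr X = po_inr (P Y) ∘ p.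
Proof. by rewrite -compA cs_map_arr po_comm. Qed.

Definition cobase_ob (X : coslice_ob B) : coslice_ob E :=
  CosliceOb (po_inr (P X)).

Definition cobase_map (X Y : coslice_ob B) (f : coslice_hom X Y) :
    coslice_hom (cobase_ob X) (cobase_ob Y) :=
  @CosliceHom C E (cobase_ob X) (cobase_ob Y)
    (po_univ (P X) (cobase_map_comm f)) (po_univr _ (cobase_map_comm f)).

(* p_* *)
Program Definition cobase_functor : functor (coslice B) (coslice E) :=
  @Functor (coslice B) (coslice E) cobase_ob cobase_map _ _.
Next Obligation.
move=> X; apply: coslice_hom_eq => /=; apply: po_uniq.
  by rewrite po_univl /= compm1 comp1m.
by rewrite po_univr comp1m.
Qed.
Next Obligation.
move=> X Y Z g f; apply: coslice_hom_eq => /=; apply: po_uniq.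
  by rewrite -[RHS]compA !po_univl [RHS]compA po_univl compA.
by rewrite -[RHS]compA !po_univr.
Qed.

Program Definition cobase_unit :
    nat_trans (functor_id (coslice B))
              (functor_comp precomp_functor cobase_functor) :=
  @NatTrans _ _ (functor_id (coslice B))
      (functor_comp precomp_functor cobase_functor)
    (fun X => @CosliceHom C B X (precomp_functor (cobase_functor X))
                (po_inl (P X)) (po_comm (P X))) _.
Next Obligation.
by move=> X Y f; apply: coslice_hom_eq => /=; rewrite po_univl.
Qed.

Lemma cobase_counit_comm (Y : coslice_ob E) :
  idm (cs_cod Y) ∘ cs_arr (precomp_functor Y) = cs_arr Y ∘ p.
Proof. by rewrite comp1m. Qed.

Program Definition cobase_counit :
    nat_trans (functor_comp cobase_functor precomp_functor)
              (functor_id (coslice E)) :=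
  @NatTrans _ _ (functor_comp cobase_functor precomp_functor)
      (functor_id (coslice E))
    (fun Y => @CosliceHom C E (cobase_functor (precomp_functor Y)) Y
                (po_univ (P (precomp_functor Y)) (cobase_counit_comm Y))
                (po_univr _ (cobase_counit_comm Y))) _.
Next Obligation.
move=> X Y f; apply: coslice_hom_eq => /=; apply: po_uniq.
  by rewrite -!compA !po_univl compA po_univl comp1m compm1.
by rewrite -!compA !po_univr cs_map_arr.
Qed.

Program Definition cobase_adjunction :
    adjunction cobase_functor precomp_functor :=
  @Adjunction _ _ cobase_functor precomp_functor cobase_unit cobase_counit _ _.
Next Obligation.
move=> X; apply: coslice_hom_eq => /=; apply: po_uniq.
  by rewrite -compA po_univl compA po_univl.
by rewrite -compA !po_univr comp1m.
Qed.
Next Obligation.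
by move=> Y; apply: coslice_hom_eq => /=; rewrite po_univl.
Qed.

(* Up to isomorphism p_* does not depend on the choice [po] of pushouts, so
   neither does this property. *)
Definition effective_codescent : Prop := comonadic cobase_adjunction.

End ChangeOfCobase.

Record ternary_ring := TernaryRing {
  tr_sort :> Type;
  tt3 : tr_sort -> tr_sort -> tr_sort -> tr_sort;
  tq3 : tr_sort -> tr_sort -> tr_sort -> tr_sort;
  tr0 : tr_sort;
  tr1 : tr_sort;
  tt3_0l : forall x y, tt3 tr0 x y = y;
  tt3_0r : forall x y, tt3 x tr0 y = y;
  tt3_1l : forall x, tt3 tr1 x tr0 = x;
  tt3_1r : forall x, tt3 x tr1 tr0 = x;
  tq3K : forall x y z, tq3 x y (tt3 x y z) = z;
  tt3K : forall x y z, tt3 x y (tq3 x y z) = z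
}.
Arguments tt3 {t} x y z.
Arguments tq3 {t} x y z.
Arguments tr0 {t}.
Arguments tr1 {t}.

Record ternary_hom (T U : ternary_ring) := TernaryHom {
  th_fun :> T -> U;
  th_t : forall x y z, th_fun (tt3 x y z) = tt3 (th_fun x) (th_fun y) (th_fun z);
  th_q : forall x y z, th_fun (tq3 x y z) = tq3 (th_fun x) (th_fun y) (th_fun z);
  th_0 : th_fun tr0 = tr0;
  th_1 : th_fun tr1 = tr1
}.

Lemma ternary_hom_eq (T U : ternary_ring) (f g : ternary_hom T U) :
  f =1 g -> f = g.
Proof.
case: f g => [f ? ? ? ?] [g ? ? ? ?] /= /funext E; subst g.
by congr TernaryHom; exact: Prop_irrelevance.
Qed.

Definition ternary_id (T : ternary_ring) : ternary_hom T T :=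
  @TernaryHom T T id (fun _ _ _ => erefl) (fun _ _ _ => erefl) erefl erefl.

Program Definition ternary_comp (T U V : ternary_ring)
    (g : ternary_hom U V) (f : ternary_hom T U) : ternary_hom T V :=
  @TernaryHom T V (fun x => g (f x)) _ _ _ _.
Next Obligation. by move=> *; rewrite /= !th_t. Qed.
Next Obligation. by move=> *; rewrite /= !th_q. Qed.
Next Obligation. by move=> *; rewrite /= !th_0. Qed.
Next Obligation. by move=> *; rewrite /= !th_1. Qed.

Program Definition TernaryRings : category :=
  @Category ternary_ring ternary_hom ternary_id ternary_comp _ _ _.
Next Obligation. by move=> *; exact: ternary_hom_eq. Qed.
Next Obligation. by move=> *; exact: ternary_hom_eq. Qed.
Next Obligation. by move=> *; exact: ternary_hom_eq. Qed.

(* The pushout of A <- B -> E is the algebra of terms over the elements of A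
   and E, modulo the congruence generated by the axioms of ternary rings, the
   operations of A and of E, and f b = p b for b in B. *)
Section TernaryPushout.
Variables (A B E : ternary_ring) (f : ternary_hom B A) (p : ternary_hom B E).

Inductive po_term : Type :=
| PoL of A
| PoR of E
| PoT of po_term & po_term & po_term
| PoQ of po_term & po_term & po_term
| Po0
| Po1.

Inductive po_cong : po_term -> po_term -> Prop :=
| po_refl u : po_cong u u
| po_sym u v : po_cong u v -> po_cong v u
| po_trans v u w : po_cong u v -> po_cong v w -> po_cong u w
| po_congT u u' v v' w w' : po_cong u u' -> po_cong v v' -> po_cong w w' ->
    po_cong (PoT u v w) (PoT u' v' w')
| po_congQ u u' v v' w w' : po_cong u u' -> po_cong v v' -> po_cong w w' ->
    po_cong (PoQ u v w) (PoQ u' v' w')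
| po_0l x y : po_cong (PoT Po0 x y) y
| po_0r x y : po_cong (PoT x Po0 y) y
| po_1l x : po_cong (PoT Po1 x Po0) x
| po_1r x : po_cong (PoT x Po1 Po0) x
| po_QT x y z : po_cong (PoQ x y (PoT x y z)) z
| po_TQ x y z : po_cong (PoT x y (PoQ x y z)) z
| po_LT x y z : po_cong (PoL (tt3 x y z)) (PoT (PoL x) (PoL y) (PoL z))
| po_LQ x y z : po_cong (PoL (tq3 x y z)) (PoQ (PoL x) (PoL y) (PoL z))
| po_L0 : po_cong (PoL tr0) Po0
| po_L1 : po_cong (PoL tr1) Po1
| po_RT x y z : po_cong (PoR (tt3 x y z)) (PoT (PoR x) (PoR y) (PoR z))
| po_RQ x y z : po_cong (PoR (tq3 x y z)) (PoQ (PoR x) (PoR y) (PoR z))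
| po_R0 : po_cong (PoR tr0) Po0
| po_R1 : po_cong (PoR tr1) Po1
| po_glue b : po_cong (PoL (f b)) (PoR (p b)).

Definition po_rel : rel {classic po_term} := fun u v => `[< po_cong u v >].

Lemma po_rel_refl : reflexive po_rel.
Proof. by move=> u; apply/asboolP; exact: po_refl. Qed.

Lemma po_rel_sym : symmetric po_rel.
Proof. by move=> u v; apply/asboolP/asboolP; exact: po_sym. Qed.

Lemma po_rel_trans : transitive po_rel.
Proof.
by move=> v u w /asboolP uv /asboolP vw; apply/asboolP; exact: po_trans uv vw.
Qed.

Canonical po_equiv_rel := EquivRel po_rel po_rel_refl po_rel_sym po_rel_trans.

Definition po_carrier : Type := {eq_quot po_equiv_rel}.

Definition po_class (u : po_term) : po_carrier :=
  \pi_{eq_quot po_equiv_rel} (u : {classic po_term}).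

Definition po_repr (x : po_carrier) : po_term :=
  generic_quotient.repr (x : {eq_quot po_equiv_rel}).

Lemma po_reprK x : po_class (po_repr x) = x.
Proof. exact: reprK. Qed.

Lemma po_classP u v : po_class u = po_class v <-> po_cong u v.
Proof.
split; first by move=> /(@eqmodP _ po_equiv_rel) /asboolP.
by move=> uv; apply/(@eqmodP _ po_equiv_rel); apply/asboolP.
Qed.

Lemma po_repr_class u : po_cong (po_repr (po_class u)) u.
Proof. by apply/po_classP; rewrite po_reprK. Qed.

Definition po_t (x y z : po_carrier) : po_carrier :=
  po_class (PoT (po_repr x) (po_repr y) (po_repr z)).

Definition po_q (x y z : po_carrier) : po_carrier :=
  po_class (PoQ (po_repr x) (po_repr y) (po_repr z)).

Lemma po_tE u v w :
  po_t (po_class u) (po_class v) (po_class w) = po_class (PoT u v w).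
Proof. by apply/po_classP/po_congT; exact: po_repr_class. Qed.

Lemma po_qE u v w :
  po_q (po_class u) (po_class v) (po_class w) = po_class (PoQ u v w).
Proof. by apply/po_classP/po_congQ; exact: po_repr_class. Qed.

Lemma po_carrierP (Q : po_carrier -> Prop) :
  (forall u, Q (po_class u)) -> forall x, Q x.
Proof. by move=> H x; rewrite -[x]po_reprK. Qed.

Program Definition po_ternary_ring : ternary_ring :=
  @TernaryRing po_carrier po_t po_q (po_class Po0) (po_class Po1) _ _ _ _ _ _.
Next Obligation.
elim/po_carrierP=> u; elim/po_carrierP=> v.
by rewrite po_tE; apply/po_classP/po_0l.
Qed.
Next Obligation.
elim/po_carrierP=> u; elim/po_carrierP=> v.
by rewrite po_tE; apply/po_classP/po_0r.
Qed.
Next Obligation.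
by elim/po_carrierP=> u; rewrite po_tE; apply/po_classP/po_1l.
Qed.
Next Obligation.
by elim/po_carrierP=> u; rewrite po_tE; apply/po_classP/po_1r.
Qed.
Next Obligation.
elim/po_carrierP=> u; elim/po_carrierP=> v; elim/po_carrierP=> w.
by rewrite po_tE po_qE; apply/po_classP/po_QT.
Qed.
Next Obligation.
elim/po_carrierP=> u; elim/po_carrierP=> v; elim/po_carrierP=> w.
by rewrite po_qE po_tE; apply/po_classP/po_TQ.
Qed.

Program Definition po_homl : ternary_hom A po_ternary_ring :=
  @TernaryHom A po_ternary_ring (fun x => po_class (PoL x)) _ _ _ _.
Next Obligation. by move=> *; rewrite /= po_tE; apply/po_classP/po_LT. Qed.
Next Obligation. by move=> *; rewrite /= po_qE; apply/po_classP/po_LQ. Qed.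
Next Obligation. by apply/po_classP/po_L0. Qed.
Next Obligation. by apply/po_classP/po_L1. Qed.

Program Definition po_homr : ternary_hom E po_ternary_ring :=
  @TernaryHom E po_ternary_ring (fun x => po_class (PoR x)) _ _ _ _.
Next Obligation. by move=> *; rewrite /= po_tE; apply/po_classP/po_RT. Qed.
Next Obligation. by move=> *; rewrite /= po_qE; apply/po_classP/po_RQ. Qed.
Next Obligation. by apply/po_classP/po_R0. Qed.
Next Obligation. by apply/po_classP/po_R1. Qed.

Section Universal.
Variables (X : ternary_ring) (a : ternary_hom A X) (e : ternary_hom E X).
Hypothesis ae : ternary_comp a f = ternary_comp e p.

Fixpoint po_eval (u : po_term) : X :=
  match u with
  | PoL x => a x
  | PoR x => e x
  | PoT u v w => tt3 (po_eval u) (po_eval v) (po_eval w)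
  | PoQ u v w => tq3 (po_eval u) (po_eval v) (po_eval w)
  | Po0 => tr0
  | Po1 => tr1
  end.

Lemma po_eval_cong u v : po_cong u v -> po_eval u = po_eval v.
Proof.
elim=> {u v} //=; try by move=> *; congruence.
- by move=> *; exact: tt3_0l.
- by move=> *; exact: tt3_0r.
- by move=> *; exact: tt3_1l.
- by move=> *; exact: tt3_1r.
- by move=> *; exact: tq3K.
- by move=> *; exact: tt3K.
- by move=> *; exact: th_t.
- by move=> *; exact: th_q.
- exact: th_0.
- exact: th_1.
- by move=> *; exact: th_t.
- by move=> *; exact: th_q.
- exact: th_0.
- exact: th_1.
- by move=> b; exact: (congr1 (fun h : ternary_hom B X => h b) ae).
Qed.

Lemma po_eval_class u : po_eval (po_repr (po_class u)) = po_eval u.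
Proof. exact/po_eval_cong/po_repr_class. Qed.

Program Definition po_hom_univ : ternary_hom po_ternary_ring X :=
  @TernaryHom po_ternary_ring X (fun x => po_eval (po_repr x)) _ _ _ _.
Next Obligation. by move=> x y z; rewrite /= po_eval_class. Qed.
Next Obligation. by move=> x y z; rewrite /= po_eval_class. Qed.
Next Obligation. by rewrite /= po_eval_class. Qed.
Next Obligation. by rewrite /= po_eval_class. Qed.

End Universal.

Program Definition ternary_pushout : @pushout TernaryRings A B E f p :=
  @Pushout TernaryRings A B E f p po_ternary_ring po_homl po_homr _
    po_hom_univ _ _ _.
Next Obligation. by apply: ternary_hom_eq => b; apply/po_classP/po_glue. Qed.
Next Obligation.
by move=> X a e H; apply: ternary_hom_eq => x; rewrite /= po_eval_class.
Qed.
Next Obligation.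
by move=> X a e H; apply: ternary_hom_eq => x; rewrite /= po_eval_class.
Qed.
Next Obligation.
move=> X u v Hl Hr; apply: ternary_hom_eq; elim/po_carrierP.
elim=> [x|x|t1 IH1 t2 IH2 t3 IH3|t1 IH1 t2 IH2 t3 IH3||].
- exact: (congr1 (fun h : ternary_hom A X => h x) Hl).
- exact: (congr1 (fun h : ternary_hom E X => h x) Hr).
- rewrite -po_tE (th_t u (po_class t1)) (th_t v (po_class t1)).
  by rewrite IH1 IH2 IH3.
- rewrite -po_qE (th_q u (po_class t1)) (th_q v (po_class t1)).
  by rewrite IH1 IH2 IH3.
- by rewrite (th_0 u) (th_0 v).
- by rewrite (th_1 u) (th_1 v).
Qed.

End TernaryPushout.

Definition ternary_pushouts : pushouts TernaryRings := ternary_pushout.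

(* [pzRingType] and [comPzRingType], unlike their [nz] variants, allow the zero
   ring. *)
Program Definition ternary_of_ring (R : pzRingType) : ternary_ring :=
  @TernaryRing R (fun a b c => a * b + c) (fun a b c => c - a * b) 0 1
    _ _ _ _ _ _.
Next Obligation. by move=> R x y; rewrite /= mul0r add0r. Qed.
Next Obligation. by move=> R x y; rewrite /= mulr0 add0r. Qed.
Next Obligation. by move=> R x; rewrite /= mul1r addr0. Qed.
Next Obligation. by move=> R x; rewrite /= mulr1 addr0. Qed.
Next Obligation. by move=> R x y z; rewrite /= addrC addKr. Qed.
Next Obligation. by move=> R x y z; rewrite /= addrC subrK. Qed.

Program Definition ternary_of_rmorphism (R S : pzRingType)
    (p : {rmorphism R -> S}) :
    @hom TernaryRings (ternary_of_ring R) (ternary_of_ring S) :=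
  @TernaryHom (ternary_of_ring R) (ternary_of_ring S) p _ _ _ _.
Next Obligation. by move=> R S p x y z; rewrite /= rmorphD rmorphM. Qed.
Next Obligation. by move=> R S p x y z; rewrite /= rmorphB rmorphM. Qed.
Next Obligation. by move=> R S p; rewrite /= rmorph0. Qed.
Next Obligation. by move=> R S p; rewrite /= rmorph1. Qed.

Local Open Scope classical_set_scope.

(* Improper ideals included, in contrast with [idealr_closed] of mathcomp. *)
Definition is_ideal (R : comPzRingType) (I : set R) : Prop :=
  [/\ I 0, forall x y, I x -> I y -> I (x + y)
    & forall a x, I x -> I (a * x)].

Definition ideal_extension_property (R S : comPzRingType)
    (p : {rmorphism R -> S}) : Prop :=
  forall I : set R, is_ideal I ->
    exists I' : set S, is_ideal I' /\ p @^-1` I' = I.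

(* Main.v *)
(* Let phi : B -> X have kernel I, and let E' = E / J be the
   pushout of B -> B/I along p.  If J pulls back to I, then X and E' share the
   copy B/I, and the pushout of X and E is the set of terms in t and q whose
   letters are elements of the amalgam of X and E' and in which no subterm can
   be simplified.  The normal form of an element is preserved by every
   injective X -> Z under B: its letters are mapped one by one.  Hence pushing
   out along p preserves injections and equalizers of pairs of injections, and
   an element w of the pushout P of X is identified with its image under
   P = X + E -> P + E only when w is a letter from X.  Applied to the structure
   map Y -> Y + E of a coalgebra and to the coprojection, both injective, this
   recovers Y from the subring on which they agree, so that the comparison
   functor is an equivalence.

   Conversely, if the comparison functor is faithful, then B/I -> B/I + S is
   injective for every ideal I of B = R, and the elements of S vanishing in
   B/I + S form an ideal extending I. *)

Require Import Defs.
From mathcomp Require Import all_boot all_order all_algebra.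
From mathcomp Require Import boolp classical_sets.
From mathcomp Require Import ring.
Import Defs.

Set Implicit Arguments.
Unset Strict Implicit.
Unset Printing Implicit Defensive.

Import GRing.Theory.

Local Open Scope ring_scope.
Local Open Scope cat_scope.

#[local] Obligation Tactic := idtac.

(** * Equivalences of categories, and isomorphisms of coslices and coalgebras *)

Lemma equivalence_faithful (C D : category) (F : functor C D) :
  is_equivalence F ->
  forall (X Y : C) (f g : hom X Y), fmap F f = fmap F g -> f = g.
Proof.
move=> [G [[a a_iso] _]] X Y f g Ffg.
have [b [ba _]] := a_iso Y.
have : a Y ∘ f = a Y ∘ g.
  by rewrite (naturality a f) (naturality a g) /= Ffg.
by move=> /(congr1 (comp b)); rewrite !compA ba !comp1m.
Qed.

Section EquivalenceCriterion.
Variables (C D : category) (F : functor C D).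
Hypothesis F_full :
  forall (X Y : C) (g : hom (F X) (F Y)), exists f, fmap F f = g.
Hypothesis F_faithful :
  forall (X Y : C) (f g : hom X Y), fmap F f = fmap F g -> f = g.
Hypothesis F_eso :
  forall Y : D, exists (X : C) (f : hom (F X) Y), is_iso f.

Let lift X Y (g : hom (F X) (F Y)) : hom X Y := projT1 (cid (F_full g)).
Let liftK X Y (g : hom (F X) (F Y)) : fmap F (lift g) = g.
Proof. exact: projT2 (cid (F_full g)). Qed.

Let inv_ob (Y : D) : C := projT1 (cid (F_eso Y)).
Let eso_ex (Y : D) : exists f : hom (F (inv_ob Y)) Y, is_iso f.
Proof. exact: projT2 (cid (F_eso Y)). Qed.

Let e (Y : D) : hom (F (inv_ob Y)) Y := projT1 (cid (eso_ex Y)).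
Let e_iso (Y : D) : is_iso (e Y).
Proof. exact: projT2 (cid (eso_ex Y)). Qed.

Let e' (Y : D) : hom Y (F (inv_ob Y)) := projT1 (cid (e_iso Y)).
Let eK (Y : D) : e' Y ∘ e Y = idm _.
Proof. exact: (projT2 (cid (e_iso Y))).1. Qed.
Let e'K (Y : D) : e Y ∘ e' Y = idm _.
Proof. exact: (projT2 (cid (e_iso Y))).2. Qed.

Let inv_map (X Y : D) (f : hom X Y) : hom (inv_ob X) (inv_ob Y) :=
  lift (e' Y ∘ f ∘ e X).

Let inv_id X : inv_map (idm X) = idm (inv_ob X).
Proof. by apply: F_faithful; rewrite liftK compm1 eK fmap_id. Qed.

Let inv_comp X Y Z (g : hom Y Z) (f : hom X Y) :
  inv_map (g ∘ f) = inv_map g ∘ inv_map f.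
Proof.
apply: F_faithful; rewrite fmap_comp !liftK !compA.
by congr (_ ∘ _ ∘ _); rewrite -[RHS]compA e'K compm1.
Qed.

Let inv_functor : functor D C := Functor inv_id inv_comp.

Let unit_nat X Y (f : hom X Y) :
  lift (e' (F Y)) ∘ fmap (functor_id C) f
  = fmap (functor_comp inv_functor F) f ∘ lift (e' (F X)).
Proof.
apply: F_faithful; rewrite /= !fmap_comp !liftK -!compA.
by rewrite e'K compm1.
Qed.

Let counit_nat X Y (f : hom X Y) :
  e Y ∘ fmap (functor_comp F inv_functor) f = fmap (functor_id D) f ∘ e X.
Proof. by rewrite /= liftK !compA e'K comp1m. Qed.

Lemma full_faithful_eso_equivalence : is_equivalence F.
Proof.
exists inv_functor; split.
  exists (@NatTrans _ _ (functor_id C) (functor_comp inv_functor F) _ unit_nat).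
  move=> X; exists (lift (e (F X))).
  by split; apply: F_faithful; rewrite fmap_comp !liftK fmap_id ?e'K ?eK.
exists (@NatTrans _ _ (functor_comp F inv_functor) (functor_id D) _ counit_nat).
by [].
Qed.

End EquivalenceCriterion.

Lemma coslice_iso (C : category) (B : C) (X Y : coslice B) (f : hom X Y) :
  is_iso (cs_map f) -> is_iso f.
Proof.
move=> [g [gf fg]].
have g_arr : g ∘ cs_arr Y = cs_arr X.
  by rewrite -(cs_map_arr f) compA gf comp1m.
by exists (CosliceHom g_arr); split; apply: coslice_hom_eq.
Qed.

Lemma coalgebra_iso (D : category) (W : comonad D) (X Y : coalgebras W)
  (f : hom X Y) : is_iso (coalg_map f) -> is_iso f.
Proof.
move=> [g [gf fg]].
have g_str : coalg_str X ∘ g = fmap W g ∘ coalg_str Y.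
  rewrite -[coalg_str X]comp1m -fmap_id -gf fmap_comp.
  by rewrite -[fmap W g ∘ _ ∘ _]compA -coalg_map_str -!compA fg compm1.
by exists (CoalgebraHom g_str); split; apply: coalgebra_hom_eq.
Qed.

(** * Ternary rings: identities, products, subrings and quotients *)

Lemma tq3_0l (T : ternary_ring) (y z : T) : tq3 tr0 y z = z.
Proof. by rewrite -{1}[z](tt3_0l y) tq3K. Qed.

Lemma tq3_0r (T : ternary_ring) (x z : T) : tq3 x tr0 z = z.
Proof. by rewrite -{1}[z](tt3_0r x) tq3K. Qed.

Lemma tq3_1l (T : ternary_ring) (x : T) : tq3 tr1 x x = tr0.
Proof. by rewrite -{2}[x]tt3_1l tq3K. Qed.

Lemma tq3_1r (T : ternary_ring) (x : T) : tq3 x tr1 x = tr0.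
Proof. by rewrite -{2}[x]tt3_1r tq3K. Qed.

Section TernaryHoms.
Variables T U : ternary_ring.

Lemma tt3_inj (x y : T) : injective (tt3 x y).
Proof. by move=> z z' E; rewrite -[z](tq3K x y) E tq3K. Qed.

(** [tq3 x y] is the inverse of the bijection [tt3 x y], so it is carried along with [tt3]. This
    spares a separate check of [tq3] in most constructions of homomorphisms below. *)
Lemma ternary_q_of_t (f : T -> U) :
  (forall x y z, f (tt3 x y z) = tt3 (f x) (f y) (f z)) ->
  forall x y z, f (tq3 x y z) = tq3 (f x) (f y) (f z).
Proof. by move=> ft x y z; rewrite -[in RHS](tt3K x y z) ft tq3K. Qed.

Definition ternary_hom_of_t (f : T -> U)
    (ft : forall x y z, f (tt3 x y z) = tt3 (f x) (f y) (f z))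
    (f0 : f tr0 = tr0) (f1 : f tr1 = tr1) : ternary_hom T U :=
  TernaryHom ft (ternary_q_of_t ft) f0 f1.

End TernaryHoms.

Lemma ternary_bij_iso (T U : ternary_ring) (f : ternary_hom T U) :
  injective f -> (forall y, exists x, f x = y) ->
  @is_iso TernaryRings T U f.
Proof.
move=> f_inj f_surj; pose g y := projT1 (cid (f_surj y)).
have gK y : f (g y) = y by exact: projT2 (cid (f_surj y)).
have gt x y z : g (tt3 x y z) = tt3 (g x) (g y) (g z).
  by apply: f_inj; rewrite th_t !gK.
have g0 : g tr0 = tr0 by apply: f_inj; rewrite gK th_0.
have g1 : g tr1 = tr1 by apply: f_inj; rewrite gK th_1.
exists (ternary_hom_of_t gt g0 g1).
split; apply: ternary_hom_eq => x; rewrite /= ?gK //.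
by apply: f_inj; rewrite gK.
Qed.

Program Definition ternary_prod (T U : ternary_ring) : ternary_ring :=
  @TernaryRing (T * U)%type
    (fun x y z => (tt3 x.1 y.1 z.1, tt3 x.2 y.2 z.2))
    (fun x y z => (tq3 x.1 y.1 z.1, tq3 x.2 y.2 z.2))
    (tr0, tr0) (tr1, tr1) _ _ _ _ _ _.
Next Obligation. by move=> T U x [y y'] /=; rewrite !tt3_0l. Qed.
Next Obligation. by move=> T U x [y y'] /=; rewrite !tt3_0r. Qed.
Next Obligation. by move=> T U [x x'] /=; rewrite !tt3_1l. Qed.
Next Obligation. by move=> T U [x x'] /=; rewrite !tt3_1r. Qed.
Next Obligation. by move=> T U x y [z z'] /=; rewrite !tq3K. Qed.
Next Obligation. by move=> T U x y [z z'] /=; rewrite !tt3K. Qed.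

Section TernarySub.
Variables (T : ternary_ring) (A : T -> Prop).
Hypotheses (At : forall x y z, A x -> A y -> A z -> A (tt3 x y z))
  (Aq : forall x y z, A x -> A y -> A z -> A (tq3 x y z))
  (A0 : A tr0) (A1 : A tr1).

Program Definition ternary_sub : ternary_ring :=
  @TernaryRing {x | A x}
    (fun x y z => exist A _ (At (svalP x) (svalP y) (svalP z)))
    (fun x y z => exist A _ (Aq (svalP x) (svalP y) (svalP z)))
    (exist A _ A0) (exist A _ A1) _ _ _ _ _ _.
Next Obligation. by move=> x [y Ay]; apply: eq_exist; rewrite /= tt3_0l. Qed.
Next Obligation. by move=> x [y Ay]; apply: eq_exist; rewrite /= tt3_0r. Qed.
Next Obligation. by move=> [x Ax]; apply: eq_exist; rewrite /= tt3_1l. Qed.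
Next Obligation. by move=> [x Ax]; apply: eq_exist; rewrite /= tt3_1r. Qed.
Next Obligation. by move=> x y [z Az]; apply: eq_exist; rewrite /= tq3K. Qed.
Next Obligation. by move=> x y [z Az]; apply: eq_exist; rewrite /= tt3K. Qed.

Definition ternary_incl : ternary_hom ternary_sub T :=
  @TernaryHom ternary_sub T (@sval T A)
    (fun _ _ _ => erefl) (fun _ _ _ => erefl) erefl erefl.

End TernarySub.

Section TernaryQuotient.
Variables (T : ternary_ring) (r : T -> T -> Prop).
Hypotheses (r_refl : forall x, r x x)
  (r_sym : forall x y, r x y -> r y x)
  (r_trans : forall x y z, r x y -> r y z -> r x z)
  (r_t : forall x x' y y' z z', r x x' -> r y y' -> r z z' ->
     r (tt3 x y z) (tt3 x' y' z'))
  (r_q : forall x x' y y' z z', r x x' -> r y y' -> r z z' ->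
     r (tq3 x y z) (tq3 x' y' z')).

Let carrier := {c : T -> Prop | exists x, c = r x}.
Let class x : carrier := exist _ (r x) (ex_intro _ x erefl).
Let repr (c : carrier) : T := projT1 (cid (svalP c)).

Let reprK c : class (repr c) = c.
Proof.
move: (projT2 (cid (svalP c))); rewrite /repr.
by case: c => c cP /= E; apply: eq_exist; rewrite -E.
Qed.

Let classP x y : class x = class y <-> r x y.
Proof.
split=> [/(congr1 sval) /= -> // | xy]; apply: eq_exist; apply: funext => z.
by apply: propext; split; apply: r_trans => //; exact: r_sym.
Qed.

Let repr_class x : r (repr (class x)) x.
Proof. by apply/classP; rewrite reprK. Qed.

Program Definition ternary_quotient : ternary_ring :=
  @TernaryRing carrier
    (fun x y z => class (tt3 (repr x) (repr y) (repr z)))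
    (fun x y z => class (tq3 (repr x) (repr y) (repr z)))
    (class tr0) (class tr1) _ _ _ _ _ _.
Next Obligation.
move=> x y; rewrite -[RHS]reprK; apply/classP.
by rewrite -[X in r _ X](tt3_0l (repr x)); apply: r_t.
Qed.
Next Obligation.
move=> x y; rewrite -[RHS]reprK; apply/classP.
by rewrite -[X in r _ X](tt3_0r (repr x)); apply: r_t.
Qed.
Next Obligation.
move=> x; rewrite -[RHS]reprK; apply/classP.
by rewrite -[X in r _ X](tt3_1l (repr x)); apply: r_t.
Qed.
Next Obligation.
move=> x; rewrite -[RHS]reprK; apply/classP.
by rewrite -[X in r _ X](tt3_1r (repr x)); apply: r_t.
Qed.
Next Obligation.
move=> x y z; rewrite -[RHS]reprK; apply/classP.
by rewrite -[X in r _ X](tq3K (repr x) (repr y)); apply: r_q.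
Qed.
Next Obligation.
move=> x y z; rewrite -[RHS]reprK; apply/classP.
by rewrite -[X in r _ X](tt3K (repr x) (repr y)); apply: r_t.
Qed.

Program Definition ternary_proj : ternary_hom T ternary_quotient :=
  @TernaryHom T ternary_quotient class _ _ _ _.
Next Obligation. by move=> *; apply/classP; apply: r_t; apply: r_sym. Qed.
Next Obligation. by move=> *; apply/classP; apply: r_q; apply: r_sym. Qed.
Next Obligation. by []. Qed.
Next Obligation. by []. Qed.

Lemma ternary_proj_surj c : exists x, ternary_proj x = c.
Proof. by exists (repr c); exact: reprK. Qed.

Lemma ternary_projP x y : ternary_proj x = ternary_proj y <-> r x y.
Proof. exact: classP. Qed.

End TernaryQuotient.

Lemma ideal_quotient (R : comPzRingType) (I : set R) : is_ideal I ->
  exists (Q : ternary_ring) (pi : ternary_hom (ternary_of_ring R) Q),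
    (forall c, exists x, pi x = c) /\ (forall x y, pi x = pi y <-> I (x - y)).
Proof.
move=> [I0 ID IM].
pose r (x y : ternary_of_ring R) := I ((x : R) - y).
have r_refl x : r x x by rewrite /r subrr.
have IN (x : R) : I x -> I (- x) by move=> /(IM (-1)); rewrite mulN1r.
have r_sym x y : r x y -> r y x by move=> /IN; rewrite opprB.
have r_trans x y z : r x y -> r y z -> r x z.
  by move=> xy yz; have := ID _ _ xy yz; rewrite addrA subrK.
have r_t x x' y y' z z' : r x x' -> r y y' -> r z z' ->
    r (tt3 x y z) (tt3 x' y' z').
  move=> xx yy zz; rewrite /r /=.
  (* [xy + z - (x'y' + z') = y(x - x') + x'(y - y') + (z - z')]; for [tq3] the first two summands
     change sign. *)
  have := ID _ _ (ID _ _ (IM y _ xx) (IM x' _ yy)) zz.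
  by congr (I _); ring.
have r_q x x' y y' z z' : r x x' -> r y y' -> r z z' ->
    r (tq3 x y z) (tq3 x' y' z').
  move=> xx yy zz; rewrite /r /=.
  have := ID _ _ (IN _ (ID _ _ (IM y _ xx) (IM x' _ yy))) zz.
  by congr (I _); ring.
exists (ternary_quotient r_refl r_sym r_trans r_t r_q).
exists (ternary_proj r_refl r_sym r_trans r_t r_q); split.
  exact: ternary_proj_surj.
by move=> x y; exact: ternary_projP.
Qed.

(** * Normal forms over an amalgam of two ternary rings *)

Inductive nterm (X E : Type) : Type :=
| NX of X
| NE of E
| NT of nterm X E & nterm X E & nterm X E
| NQ of nterm X E & nterm X E & nterm X E.
Arguments NX {X E} _.
Arguments NE {X E} _.

Lemma NT_neq1 (X E : Type) (u v w : nterm X E) : NT u v w <> u.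
Proof. by elim: u v w => // a IH b _ c _ v w [/IH]. Qed.

Lemma NT_neq2 (X E : Type) (u v w : nterm X E) : NT u v w <> v.
Proof. by elim: v u w => // a _ b IH c _ u w [_ /IH]. Qed.

Section NormalForms.
Variables (B E X : ternary_ring).
Variables (rho : ternary_hom B E) (phi : ternary_hom B X).
(** Equal kernels make the images of [B] in [E] and in [X] the same quotient of [B], so identifying
    [rho b] with [phi b] merges no two elements of [X] and no two elements of [E]. *)
Hypothesis same_ker : forall b b', rho b = rho b' <-> phi b = phi b'.

Notation term := (nterm X E).
Let zero : term := NX tr0.
Let one : term := NX tr1.

(* The letter of s in the amalgam of X and E over B: normal terms contain NE s
   only for s outside the image of B. *)
Definition glue (s : E) : term :=
  if pselect (exists b, rho b = s) is left H then NX (phi (projT1 (cid H)))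
  else NE s.

Lemma glue_rho b : glue (rho b) = NX (phi b).
Proof.
rewrite /glue; case: pselect => [H | []]; last by exists b.
by congr NX; apply/same_ker; exact: (projT2 (cid H)).
Qed.

Lemma glue_out s : (forall b, rho b <> s) -> glue s = NE s.
Proof.
by rewrite /glue => H; case: pselect => // b_ex; case: b_ex => b e; case: (H b).
Qed.

Variant glue_spec s : term -> Prop :=
| GlueIn b of s = rho b : glue_spec s (NX (phi b))
| GlueOut of (forall b, rho b <> s) : glue_spec s (NE s).

Lemma glueP s : glue_spec s (glue s).
Proof.
have [[b <-] | H] := pselect (exists b, rho b = s).
  by rewrite glue_rho; apply: GlueIn.
have out b : rho b <> s by move=> Hb; apply: H; exists b.
by rewrite glue_out //; apply: GlueOut.
Qed.

Lemma glue_inj : injective glue.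
Proof.
move=> s s'; case: glueP => [b ->|_]; case: glueP => [b' ->|_] // [] //.
by move=> ?; apply/same_ker.
Qed.

Lemma glue_NX s x : glue s = NX x -> exists b, s = rho b /\ x = phi b.
Proof. by case: glueP => // b -> [<-]; exists b. Qed.

Lemma glue0 : glue tr0 = zero.
Proof. by rewrite -(th_0 rho) glue_rho th_0. Qed.

Lemma glue1 : glue tr1 = one.
Proof. by rewrite -(th_1 rho) glue_rho th_1. Qed.

Lemma glue_t s1 s2 s3 x y z : glue s1 = NX x -> glue s2 = NX y ->
  glue s3 = NX z -> glue (tt3 s1 s2 s3) = NX (tt3 x y z).
Proof.
move=> /glue_NX [b1 [-> ->]] /glue_NX [b2 [-> ->]] /glue_NX [b3 [-> ->]].
by rewrite -!th_t glue_rho.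
Qed.

Lemma glue_q s1 s2 s3 x y z : glue s1 = NX x -> glue s2 = NX y ->
  glue s3 = NX z -> glue (tq3 s1 s2 s3) = NX (tq3 x y z).
Proof.
move=> /glue_NX [b1 [-> ->]] /glue_NX [b2 [-> ->]] /glue_NX [b3 [-> ->]].
by rewrite -!th_q glue_rho.
Qed.

(* The instances t(u,v,w) = r that hold without creating a new term. *)
Inductive base (u v w r : term) : Prop :=
| base_X x y z of u = NX x & v = NX y & w = NX z & r = NX (tt3 x y z)
| base_E x y z of u = glue x & v = glue y & w = glue z & r = glue (tt3 x y z)
| base_0l of u = zero & r = w
| base_0r of v = zero & r = w
| base_1l of u = one & w = zero & r = v
| base_1r of v = one & w = zero & r = u.

(** The clauses of [base] overlap. This lemma and the following ones check that they agree on
    overlaps, read forwards as [t] and, in the lemmas with suffix [_inv], backwards as [q]. *)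
Lemma base_NX x y z r : base (NX x) (NX y) (NX z) r -> r = NX (tt3 x y z).
Proof.
case=> [x' y' z' [->] [->] [->] //|s1 s2 s3 e1 e2 e3 ->|[->] ->|[->] ->
       |[->] [->] ->|[->] [->] ->].
- exact: glue_t.
- by rewrite tt3_0l.
- by rewrite tt3_0r.
- by rewrite tt3_1l.
- by rewrite tt3_1r.
Qed.

Lemma base_NX_inv x y z w : base (NX x) (NX y) w (NX z) -> w = NX (tq3 x y z).
Proof.
case=> [x' y' z' [->] [->] -> [->]|s1 s2 s3 e1 e2 -> e3|[->] <-|[->] <-
       |[->] -> [->]|[->] -> [->]].
- by rewrite tq3K.
- by rewrite -(glue_q (esym e1) (esym e2) (esym e3)) tq3K.
- by rewrite tq3_0l.
- by rewrite tq3_0r.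
- by rewrite tq3_1l.
- by rewrite tq3_1r.
Qed.

Let glue_0 s : glue s = zero -> s = tr0.
Proof. by rewrite -glue0 => /glue_inj. Qed.

Let glue_1 s : glue s = one -> s = tr1.
Proof. by rewrite -glue1 => /glue_inj. Qed.

Lemma base_glue x y z r :
  base (glue x) (glue y) (glue z) r -> r = glue (tt3 x y z).
Proof.
case=> [x' y' z' e1 e2 e3 ->|s1 s2 s3|/glue_0 -> ->|/glue_0 -> ->
       |/glue_1 -> /glue_0 -> ->|/glue_1 -> /glue_0 -> ->].
- by rewrite (glue_t e1 e2 e3).
- by move=> /glue_inj -> /glue_inj -> /glue_inj ->.
- by rewrite tt3_0l.
- by rewrite tt3_0r.
- by rewrite tt3_1l.
- by rewrite tt3_1r.
Qed.

Lemma base_glue_inv x y z w :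
  base (glue x) (glue y) w (glue z) -> w = glue (tq3 x y z).
Proof.
case=> [x' y' z' e1 e2 -> e3|s1 s2 s3|/glue_0 -> <-|/glue_0 -> <-
       |/glue_1 -> -> /glue_inj ->|/glue_1 -> -> /glue_inj ->].
- by rewrite (glue_q e1 e2 e3) tq3K.
- by move=> /glue_inj -> /glue_inj -> -> /glue_inj ->; rewrite tq3K.
- by rewrite tq3_0l.
- by rewrite tq3_0r.
- by rewrite tq3_1l glue0.
- by rewrite tq3_1r glue0.
Qed.

(* If 0 = 1 then [base_0l] and [base_1l] disagree; in that case [zero] is the
   only normal term. *)
Section Nontrivial.
Hypothesis one_neq0 : one <> zero.

Lemma base_zl v w r : base zero v w r -> r = w.
Proof.
case=> [x y z [<-] _ -> ->|x y z /esym/glue_0 -> _ -> ->|_ -> //|_ -> //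
       |/esym //|_ -> -> //].
- by rewrite tt3_0l.
- by rewrite tt3_0l.
Qed.

Lemma base_zr u w r : base u zero w r -> r = w.
Proof.
case=> [x y z _ [<-] -> ->|x y z _ /esym/glue_0 -> -> ->|_ -> //|_ -> //
       |_ -> -> //|/esym //].
- by rewrite tt3_0r.
- by rewrite tt3_0r.
Qed.

Lemma base_ol v r : base one v zero r -> r = v.
Proof.
case=> [x y z [<-] -> [<-] ->|x y z /esym/glue_1 -> -> /esym/glue_0 -> ->
       |//|-> -> //|_ _ -> //|-> _ -> //].
- by rewrite tt3_1l.
- by rewrite tt3_1l.
Qed.

Lemma base_or u r : base u one zero r -> r = u.
Proof.
case=> [x y z -> [<-] [<-] ->|x y z -> /esym/glue_1 -> /esym/glue_0 -> ->
       |-> -> //|//|-> _ -> //|_ _ -> //].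
- by rewrite tt3_1r.
- by rewrite tt3_1r.
Qed.

Lemma base_ol_inv v w : base one v w v -> w = zero.
Proof.
case=> [x y z [<-] -> -> []|x y z /esym/glue_1 -> -> -> /glue_inj
       |//|-> -> //|_ -> _ //|_ -> _ //].
- by rewrite -{1}[y]tt3_1l => /tt3_inj <-.
- by rewrite -{1}[y]tt3_1l => /tt3_inj <-; rewrite glue0.
Qed.

Lemma base_or_inv u w : base u one w u -> w = zero.
Proof.
case=> [x y z -> [<-] -> []|x y z -> /esym/glue_1 -> -> /glue_inj
       |-> -> //|//|_ -> _ //|_ -> _ //].
- by rewrite -{1}[x]tt3_1r => /tt3_inj <-.
- by rewrite -{1}[x]tt3_1r => /tt3_inj <-; rewrite glue0.
Qed.

Lemma base_fun u v w r r' : base u v w r -> base u v w r' -> r = r'.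
Proof.
case=> [x y z -> -> -> ->|x y z -> -> -> ->|-> ->|-> ->|-> -> ->|-> -> ->].
- by move=> /base_NX.
- by move=> /base_glue.
- by move=> /base_zl.
- by move=> /base_zr.
- by move=> /base_ol.
- by move=> /base_or.
Qed.

Lemma base_inj u v w w' r : base u v w r -> base u v w' r -> w = w'.
Proof.
case=> [x y z -> -> -> ->|x y z -> -> -> ->|-> ->|-> ->|-> -> ->|-> -> ->].
- by move=> /base_NX_inv ->; rewrite tq3K.
- by move=> /base_glue_inv ->; rewrite tq3K.
- by move=> /base_zl.
- by move=> /base_zr.
- by move=> /base_ol_inv.
- by move=> /base_or_inv.
Qed.

End Nontrivial.

Lemma glue_neqT s u v w : glue s <> NT u v w.
Proof. by case: glueP. Qed.

Lemma glue_neqQ s u v w : glue s <> NQ u v w.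
Proof. by case: glueP. Qed.

(** No letter is a compound term, so only the 0-laws can apply to the last argument [NQ u v r], and
    they apply to [r] as well. The conclusion contradicts normality of [NQ u v r]. *)
Lemma base_argQ u v w r : base u v (NQ u v r) w -> base u v r r.
Proof.
case=> [//|x y z _ _ /esym/glue_neqQ //|-> _|-> _|//|//].
  exact: base_0l.
exact: base_0r.
Qed.

(** Dual to [base_argQ]. The 1-laws are excluded because they would make [NT u v r] equal to its own
    subterm [u] or [v]. *)
Lemma base_valT u v w r : base u v w (NT u v r) -> base u v r r.
Proof.
case=> [//|x y z _ _ _ /esym/glue_neqT //|-> _|-> _
       |_ _ /NT_neq2 //|_ _ /NT_neq1 //].
  exact: base_0l.
exact: base_0r.
Qed.

(** [base u v w r] read backwards says [q(u,v,r) = w], so any such [w] makes [NQ u v r] reducible.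
    The last conditions exclude the redexes [t(u,v,q(u,v,z))] and [q(u,v,t(u,v,z))]. *)
Fixpoint normal (u : term) : Prop :=
  match u with
  | NX _ => True
  | NE s => forall b, rho b <> s
  | NT u v w => [/\ normal u, normal v, normal w,
      forall r, ~ base u v w r & forall z, w <> NQ u v z]
  | NQ u v r => [/\ normal u, normal v, normal r,
      forall w, ~ base u v w r & forall z, r <> NT u v z]
  end.

Lemma normal_glue s : normal (glue s).
Proof. by case: glueP. Qed.

Lemma base_normal u v w r :
  base u v w r -> normal u -> normal v -> normal w <-> normal r.
Proof.
case=> [x y z _ _ -> ->|x y z _ _ -> ->|_ ->|_ ->|_ -> ->|_ -> ->] //.
by move=> _ _; split=> _; exact: normal_glue.
Qed.

(** If [0 = 1] in [X], equality of kernels gives the same in [E], and [x = t(1,x,0) = t(0,x,0) = 0]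
    collapses both. A compound term then starts with [zero], so [base_0l] reduces it. *)
Lemma normal_trivial u : one = zero -> normal u -> u = zero.
Proof.
move=> [one0]; elim: u => [x _|s s_out|u IHu v _ w _|u IHu v _ w _].
- by rewrite -[x]tt3_1l one0 tt3_0l.
- case: (s_out tr0); rewrite -[s]tt3_1l.
  have -> : tr1 = tr0 :> E.
    by rewrite -(th_1 rho) -(th_0 rho); apply/same_ker; rewrite th_1 th_0.
  by rewrite tt3_0l th_0.
- by move=> [/IHu -> _ _ nb _]; case: (nb w); exact: base_0l.
- by move=> [/IHu -> _ _ nb _]; case: (nb w); exact: base_0l.
Qed.

(* The graph of t on normal terms, symmetric under exchanging (w, T) with
   (r, Q); so q has the same graph read backwards. *)
Inductive op (u v w r : term) : Prop :=
| op_base of base u v w r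
| op_T of (forall r', ~ base u v w r') & (forall z, w <> NQ u v z)
    & r = NT u v w
| op_Q of (forall w', ~ base u v w' r) & (forall z, r <> NT u v z)
    & w = NQ u v r.

Lemma op_normal u v w r :
  op u v w r -> normal u -> normal v -> normal w <-> normal r.
Proof.
case=> [|nb nQ ->|nb nT ->]; first exact: base_normal.
  by move=> nu nv; split=> [|[]].
by move=> nu nv; split=> [[]|].
Qed.

(** The clauses of [op] exclude one another: [op_T] rules out [op_base] and [op_Q] by its premises,
    and [base_argQ] separates [op_base] from [op_Q]. Within [op_base] the rules agree unless
    [0 = 1], when all normal terms coincide. *)
Lemma op_fun u v w r r' : normal u -> normal v -> normal w ->
  op u v w r -> op u v w r' -> r = r'.
Proof.
move=> nu nv nw o o'.
have [one0 | one_neq0] := pselect (one = zero).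
  have nr := (op_normal o nu nv).1 nw; have nr' := (op_normal o' nu nv).1 nw.
  by rewrite (normal_trivial one0 nr) (normal_trivial one0 nr').
case: o => [b|nb nQ ->|nb nT e]; case: o' => [b'|nb' nQ' -> //|nb' nT' e'].
- exact: (base_fun one_neq0 b b').
- by case: (nb' _ b).
- by move: b; rewrite e' => /base_argQ /nb'.
- by case: (nb _ b').
- by case: (nQ _ e').
- by move: b'; rewrite e => /base_argQ /nb.
- by case: (nQ' _ e).
- by move: e'; rewrite e => -[].
Qed.

Lemma op_inj u v w w' r : normal u -> normal v -> normal r ->
  op u v w r -> op u v w' r -> w = w'.
Proof.
move=> nu nv nr o o'.
have [one0 | one_neq0] := pselect (one = zero).
  have nw := (op_normal o nu nv).2 nr; have nw' := (op_normal o' nu nv).2 nr.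
  by rewrite (normal_trivial one0 nw) (normal_trivial one0 nw').
case: o => [b|nb nQ e|nb nT ->]; case: o' => [b'|nb' nQ' e'|nb' nT' -> //].
- exact: (base_inj one_neq0 b b').
- by move: b; rewrite e' => /base_valT /nb'.
- by case: (nb' _ b).
- by move: b'; rewrite e => /base_valT /nb.
- by move: e'; rewrite e => -[].
- by case: (nT' _ e).
- by case: (nb _ b').
- by case: (nT _ e').
Qed.

Lemma op_total u v w : normal w -> exists r, op u v w r.
Proof.
move=> nw; have [[r b]|nb] := pselect (exists r, base u v w r).
  by exists r; apply: op_base.
have [[z e]|nQ] := pselect (exists z, w = NQ u v z).
  (* Normality of [NQ u v z] consists in part of the premises of [op_Q]. *)
  by exists z; move: nw; rewrite e => -[_ _ _ nb' nT]; apply: op_Q.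
exists (NT u v w); apply: op_T => // [r' b|z e].
  by apply: nb; exists r'.
by apply: nQ; exists z.
Qed.

Lemma op_surj u v r : normal r -> exists w, op u v w r.
Proof.
move=> nr; have [[w b]|nb] := pselect (exists w, base u v w r).
  by exists w; apply: op_base.
have [[z e]|nT] := pselect (exists z, r = NT u v z).
  by exists z; move: nr; rewrite e => -[_ _ _ nb' nQ]; apply: op_T.
exists (NQ u v r); apply: op_Q => // [w' b|z e].
  by apply: nb; exists w'.
by apply: nT; exists z.
Qed.

Let nf_ob := {u : term | normal u}.

Let t_ex (u v w : nf_ob) :
  exists r : nf_ob, op (sval u) (sval v) (sval w) (sval r).
Proof.
have [r o] := op_total (sval u) (sval v) (svalP w).
by exists (exist _ r ((op_normal o (svalP u) (svalP v)).1 (svalP w))).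
Qed.

Let q_ex (u v r : nf_ob) :
  exists w : nf_ob, op (sval u) (sval v) (sval w) (sval r).
Proof.
have [w o] := op_surj (sval u) (sval v) (svalP r).
by exists (exist _ w ((op_normal o (svalP u) (svalP v)).2 (svalP r))).
Qed.

Let nt (u v w : nf_ob) : nf_ob := projT1 (cid (t_ex u v w)).
Let nq (u v w : nf_ob) : nf_ob := projT1 (cid (q_ex u v w)).
Let ntP u v w : op (sval u) (sval v) (sval w) (sval (nt u v w)).
Proof. exact: projT2 (cid (t_ex u v w)). Qed.
Let nqP u v w : op (sval u) (sval v) (sval (nq u v w)) (sval w).
Proof. exact: projT2 (cid (q_ex u v w)). Qed.

Let nf_eq (u v : nf_ob) : sval u = sval v -> u = v.
Proof. by case: u v => u nu [v nv] /= E0; apply: eq_exist. Qed.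

Let nt_op u v w r : op (sval u) (sval v) (sval w) (sval r) -> nt u v w = r.
Proof.
by move=> o; apply: nf_eq; apply: op_fun (ntP u v w) o; exact: svalP.
Qed.

Definition nf_zero : nf_ob := exist _ zero I.
Definition nf_one : nf_ob := exist _ one I.

Program Definition nf_ring : ternary_ring :=
  @TernaryRing nf_ob nt nq nf_zero nf_one _ _ _ _ _ _.
Next Obligation. by move=> x y; apply/nt_op/op_base/base_0l. Qed.
Next Obligation. by move=> x y; apply/nt_op/op_base/base_0r. Qed.
Next Obligation. by move=> x; apply/nt_op/op_base/base_1l. Qed.
Next Obligation. by move=> x; apply/nt_op/op_base/base_1r. Qed.
Next Obligation.
move=> x y z; apply: nf_eq.
by apply: op_inj (nqP x y (nt x y z)) (ntP x y z); exact: svalP.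
Qed.
Next Obligation. by move=> x y z; apply/nt_op/nqP. Qed.

Lemma nf_opP (u v w : nf_ring) :
  op (sval u) (sval v) (sval w) (sval (tt3 u v w)).
Proof. exact: ntP. Qed.

Lemma nf_op (u v w r : nf_ring) :
  op (sval u) (sval v) (sval w) (sval r) -> tt3 u v w = r.
Proof. exact: nt_op. Qed.

Program Definition nf_homX : ternary_hom X nf_ring :=
  @ternary_hom_of_t X nf_ring (fun x => exist _ (NX x) I) _ _ _.
Next Obligation.
by move=> x y z; apply/esym/nf_op/op_base; apply: base_X.
Qed.
Next Obligation. by []. Qed.
Next Obligation. by []. Qed.

Program Definition nf_homE : ternary_hom E nf_ring :=
  @ternary_hom_of_t E nf_ring (fun s => exist _ (glue s) (normal_glue s)) _ _ _.
Next Obligation.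
by move=> x y z; apply/esym/nf_op/op_base; apply: base_E.
Qed.
Next Obligation. exact/nf_eq/glue0. Qed.
Next Obligation. exact/nf_eq/glue1. Qed.

Lemma nf_hom_glue : ternary_comp nf_homX phi = ternary_comp nf_homE rho.
Proof. by apply: ternary_hom_eq => b; apply: nf_eq; rewrite /= glue_rho. Qed.

End NormalForms.

(** * Functoriality of normal forms along injections *)

Fixpoint nmap (X Z E : Type) (h : X -> Z) (u : nterm X E) : nterm Z E :=
  match u with
  | NX x => NX (h x)
  | NE s => NE s
  | NT u v w => NT (nmap h u) (nmap h v) (nmap h w)
  | NQ u v w => NQ (nmap h u) (nmap h v) (nmap h w)
  end.

Lemma nmap_inj (X Z E : Type) (h : X -> Z) :
  injective h -> injective (@nmap X Z E h).
Proof.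
move=> h_inj; elim=> [x|s|u IHu v IHv w IHw|u IHu v IHv w IHw]
  [x'|s'|u' v' w'|u' v' w'] //=.
- by move=> [/h_inj ->].
- by move=> [->].
- by move=> [/IHu -> /IHv -> /IHw ->].
- by move=> [/IHu -> /IHv -> /IHw ->].
Qed.

(** Constructors are injective, so the two images agree letter by letter and the hypothesis applies
    to each letter of [X]. *)
Lemma nmap_equalizer (L X Z E : Type) (e : L -> X) (f g : X -> Z) :
  (forall x, f x = g x -> exists l, e l = x) ->
  forall u : nterm X E, nmap f u = nmap g u -> exists u', nmap e u' = u.
Proof.
move=> eqz; elim=> [x|s|u IHu v IHv w IHw|u IHu v IHv w IHw] /=.
- by move=> [/eqz [l <-]]; exists (NX l).
- by move=> _; exists (NE s).
- move=> [/IHu [u' <-] /IHv [v' <-] /IHw [w' <-]].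
  by exists (NT u' v' w').
- move=> [/IHu [u' <-] /IHv [v' <-] /IHw [w' <-]].
  by exists (NQ u' v' w').
Qed.

Section NormalFormsMap.
Variables (B E X Z : ternary_ring) (rho : ternary_hom B E).
Variables (phi : ternary_hom B X) (psi : ternary_hom B Z).
Hypothesis kerX : forall b b', rho b = rho b' <-> phi b = phi b'.
Hypothesis kerZ : forall b b', rho b = rho b' <-> psi b = psi b'.
Variable h : ternary_hom X Z.
Hypotheses (h_inj : injective h) (h_arr : forall b, h (phi b) = psi b).

Let hmap : nterm X E -> nterm Z E := nmap h.
Let hmap_inj : injective hmap := nmap_inj h_inj.
Let glueX := glue rho phi.
Let glueZ := glue rho psi.

Let hmap_glue s : hmap (glueX s) = glueZ s.
Proof.
rewrite /glueX; case: glueP => // [b ->|s_out].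
  by rewrite /glueZ glue_rho // /hmap /= h_arr.
by rewrite /glueZ glue_out.
Qed.

Let hmap_NX u z : hmap u = NX z -> exists x, u = NX x /\ z = h x.
Proof. by case: u => //= x [<-]; exists x. Qed.

Let hmap_0 : hmap (NX tr0) = NX tr0. Proof. by rewrite /hmap /= th_0. Qed.
Let hmap_1 : hmap (NX tr1) = NX tr1. Proof. by rewrite /hmap /= th_1. Qed.

Let hmap_base u v w r :
  base rho phi u v w r -> base rho psi (hmap u) (hmap v) (hmap w) (hmap r).
Proof.
case=> [x y z -> -> -> ->|x y z -> -> -> ->|-> ->|-> ->|-> -> ->|-> -> ->].
- by apply: (@base_X _ _ _ _ _ _ _ _ _ (h x) (h y) (h z));
    rewrite // /hmap /= th_t.
- by apply: (@base_E _ _ _ _ _ _ _ _ _ x y z); exact: hmap_glue.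
- by apply: base_0l; rewrite ?hmap_0.
- by apply: base_0r; rewrite ?hmap_0.
- by apply: base_1l; rewrite ?hmap_0 ?hmap_1.
- by apply: base_1r; rewrite ?hmap_0 ?hmap_1.
Qed.

Let eq_glue u s : hmap u = glueZ s -> u = glueX s.
Proof. by rewrite -hmap_glue => /hmap_inj. Qed.
Let eq_0 u : hmap u = NX tr0 -> u = NX tr0.
Proof. by rewrite -hmap_0 => /hmap_inj. Qed.
Let eq_1 u : hmap u = NX tr1 -> u = NX tr1.
Proof. by rewrite -hmap_1 => /hmap_inj. Qed.

(** Since [hmap] is injective and sends letters of [X] to letters of [Z], a clause of [base] that
    matches the images already matches the original terms. With [hmap_baseV] this shows that [hmap]
    creates no redexes, so normal terms stay normal. *)
Let hmap_baseW u v w r' : base rho psi (hmap u) (hmap v) (hmap w) r' ->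
  exists r, base rho phi u v w r.
Proof.
case=> [x y z|x y z|/eq_0 -> _|/eq_0 -> _|/eq_1 -> /eq_0 -> _
       |/eq_1 -> /eq_0 -> _].
- move=> /hmap_NX [x' [-> _]] /hmap_NX [y' [-> _]] /hmap_NX [z' [-> _]] _.
  by exists (NX (tt3 x' y' z')); apply: base_X.
- move=> /eq_glue -> /eq_glue -> /eq_glue -> _.
  by exists (glueX (tt3 x y z)); apply: base_E.
- by exists w; apply: base_0l.
- by exists w; apply: base_0r.
- by exists v; apply: base_1l.
- by exists u; apply: base_1r.
Qed.

Let hmap_baseV u v w' r : base rho psi (hmap u) (hmap v) w' (hmap r) ->
  exists w, base rho phi u v w r.
Proof.
case=> [x y z|x y z|/eq_0 -> _|/eq_0 -> _|/eq_1 -> _ /hmap_inj ->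
       |/eq_1 -> _ /hmap_inj ->].
- move=> /hmap_NX [x' [-> _]] /hmap_NX [y' [-> _]] _ /hmap_NX [z' [-> _]].
  exists (NX (tq3 x' y' z')).
  by apply: (@base_X _ _ _ _ _ _ _ _ _ x' y' (tq3 x' y' z')); rewrite ?tt3K.
- move=> /eq_glue -> /eq_glue -> _ e.
  exists (glueX (tq3 x y (tt3 x y z))).
  apply: (@base_E _ _ _ _ _ _ _ _ _ x y z) => //; first by rewrite tq3K.
  exact: eq_glue.
- by exists r; apply: base_0l.
- by exists r; apply: base_0r.
- by exists (NX tr0); apply: base_1l.
- by exists (NX tr0); apply: base_1r.
Qed.

Let hmap_neqT u v r z : (forall c, r <> NT u v c) ->
  hmap r <> NT (hmap u) (hmap v) z.
Proof.
case: r => // a b c nT [/hmap_inj ea /hmap_inj eb _].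
by case: (nT c); rewrite ea eb.
Qed.

Let hmap_neqQ u v w z : (forall c, w <> NQ u v c) ->
  hmap w <> NQ (hmap u) (hmap v) z.
Proof.
case: w => // a b c nQ [/hmap_inj ea /hmap_inj eb _].
by case: (nQ c); rewrite ea eb.
Qed.

Let hmap_op u v w r :
  op rho phi u v w r -> op rho psi (hmap u) (hmap v) (hmap w) (hmap r).
Proof.
case=> [/hmap_base|nb nQ ->|nb nT ->]; first exact: op_base.
  apply: op_T => // [r' /hmap_baseW [r0 /nb] //|z].
  exact: hmap_neqQ.
apply: op_Q => // [w' /hmap_baseV [w0 /nb] //|z].
exact: hmap_neqT.
Qed.

Let hmap_normal u : normal rho phi u -> normal rho psi (hmap u).
Proof.
elim: u => [x|s|u IHu v IHv w IHw|u IHu v IHv w IHw] //=.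
- move=> [/IHu nu /IHv nv /IHw nw nb nQ].
  by split=> // [r' /hmap_baseW [r /nb] //|z]; exact: hmap_neqQ.
- move=> [/IHu nu /IHv nv /IHw nw nb nT].
  by split=> // [r' /hmap_baseV [r /nb] //|z]; exact: hmap_neqT.
Qed.

Program Definition nf_map : ternary_hom (nf_ring kerX) (nf_ring kerZ) :=
  @ternary_hom_of_t (nf_ring kerX) (nf_ring kerZ)
    (fun u => exist _ (hmap (sval u)) (hmap_normal (svalP u))) _ _ _.
Next Obligation.
by move=> u v w; apply/esym/nf_op; apply: hmap_op; exact: nf_opP.
Qed.
Next Obligation. exact/eq_exist/hmap_0. Qed.
Next Obligation. exact/eq_exist/hmap_1. Qed.

End NormalFormsMap.

(** * Pushouts of ternary rings in normal form *)

Lemma po_hom_eq (A B E X : ternary_ring) (f : ternary_hom B A)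
    (p : ternary_hom B E) (u v : ternary_hom (po_ternary_ring f p) X) :
  (forall x, u (po_homl f p x) = v (po_homl f p x)) ->
  (forall s, u (po_homr f p s) = v (po_homr f p s)) -> forall w, u w = v w.
Proof.
move=> uvl uvr w.
suff -> : u = v by [].
by apply: (@po_uniq _ _ _ _ _ _ (ternary_pushout f p)); exact: ternary_hom_eq.
Qed.

Lemma po_glueE (A B E : ternary_ring) (f : ternary_hom B A)
    (p : ternary_hom B E) b : po_homl f p (f b) = po_homr f p (p b).
Proof. exact/po_classP/po_glue. Qed.

(* [pi] is the pushout along [p] of the projection of B onto B / ker phi, and
   B / ker phi embeds into it. *)
Definition extends_kernel (B E E' X : ternary_ring) (p : ternary_hom B E)
    (phi : ternary_hom B X) (pi : ternary_hom E E') : Prop :=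
  [/\ forall c, exists s, pi s = c,
    forall b b', pi (p b) = pi (p b') <-> phi b = phi b'
  & forall (Y : ternary_ring) (e : ternary_hom E Y),
      (forall b b', phi b = phi b' -> e (p b) = e (p b')) ->
      forall s s', pi s = pi s' -> e s = e s'].

Lemma extends_ker (B E E' X : ternary_ring) (p : ternary_hom B E)
    (phi : ternary_hom B X) (pi : ternary_hom E E') :
  extends_kernel p phi pi -> forall b b',
  ternary_comp pi p b = ternary_comp pi p b' <-> phi b = phi b'.
Proof. by case. Qed.

Section PushoutNormalForms.
Variables (B E E' X : ternary_ring) (p : ternary_hom B E).
Variables (phi : ternary_hom B X) (pi : ternary_hom E E').
Hypothesis ext : extends_kernel p phi pi.

Let pi_surj c : exists s, pi s = c. Proof. by have [] := ext. Qed.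
Let rho := ternary_comp pi p.
Let ker := extends_ker ext.

Let N := nf_ring ker.
Let P := po_ternary_ring phi p.
Let inl := po_homl phi p.
Let inr := po_homr phi p.

Let nf_glue : ternary_comp (nf_homX ker) phi
  = ternary_comp (ternary_comp (nf_homE ker) pi) p.
Proof.
apply: ternary_hom_eq => b.
exact: (congr1 (fun k : ternary_hom B N => k b) (nf_hom_glue ker)).
Qed.

Definition po_nf : ternary_hom P N := po_hom_univ nf_glue.

Lemma po_nf_inl x : po_nf (inl x) = nf_homX ker x.
Proof. exact: (po_eval_class nf_glue). Qed.

Lemma po_nf_inr s : po_nf (inr s) = nf_homE ker (pi s).
Proof. exact: (po_eval_class nf_glue). Qed.

Definition pi_section (c : E') : E := projT1 (cid (pi_surj c)).

Fixpoint po_of_nterm (u : nterm X E') : P :=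
  match u with
  | NX x => inl x
  | NE c => inr (pi_section c)
  | NT u v w => tt3 (po_of_nterm u) (po_of_nterm v) (po_of_nterm w)
  | NQ u v w => tq3 (po_of_nterm u) (po_of_nterm v) (po_of_nterm w)
  end.

(** The gluing relation makes [inr] satisfy the hypothesis of the universal property of [pi], so
    [inr] factors through [pi]. Hence the choice made in [pi_section] does not affect
    [po_of_nterm]. *)
Let inr_pi s s' : pi s = pi s' -> inr s = inr s'.
Proof.
have [_ _ fac] := ext; apply: fac => b b' e.
by rewrite /inr -!po_glueE e.
Qed.

Let pi_sectionK c : pi (pi_section c) = c.
Proof. exact: projT2 (cid (pi_surj c)). Qed.

Lemma po_of_glue c : po_of_nterm (glue rho phi c) = inr (pi_section c).
Proof.
case: glueP => //= b c_b; rewrite [LHS](po_glueE phi p b); apply: inr_pi.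
by rewrite pi_sectionK c_b.
Qed.

Let po_of_op u v w r : op rho phi u v w r ->
  tt3 (po_of_nterm u) (po_of_nterm v) (po_of_nterm w) = po_of_nterm r.
Proof.
have z0 : po_of_nterm (NX tr0) = tr0 by exact: (th_0 inl).
have o1 : po_of_nterm (NX tr1) = tr1 by exact: (th_1 inl).
case=> [[x y z -> -> -> ->|x y z -> -> -> ->|-> ->|-> ->|-> -> ->|-> -> ->]
       |_ _ -> //|_ _ ->].
- exact: (esym (th_t inl x y z)).
- rewrite !po_of_glue -(th_t inr); apply: inr_pi.
  by rewrite th_t !pi_sectionK.
- by rewrite z0 tt3_0l.
- by rewrite z0 tt3_0r.
- by rewrite z0 o1 tt3_1l.
- by rewrite z0 o1 tt3_1r.
- exact: tt3K.
Qed.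

(** Evaluation of normal forms is a homomorphism by [po_of_op], and after [po_nf] it fixes both
    coprojections, hence everything. In particular [po_nf] is injective. *)
Lemma po_nfK w : po_of_nterm (sval (po_nf w)) = w.
Proof.
have ft (u v w' : N) : po_of_nterm (sval (tt3 u v w'))
    = tt3 (po_of_nterm (sval u)) (po_of_nterm (sval v)) (po_of_nterm (sval w')).
  exact/esym/po_of_op/nf_opP.
have f0 : po_of_nterm (sval (tr0 : N)) = tr0 by exact: (th_0 inl).
have f1 : po_of_nterm (sval (tr1 : N)) = tr1 by exact: (th_1 inl).
pose k : ternary_hom N P := ternary_hom_of_t ft f0 f1.
apply: (po_hom_eq (u := ternary_comp k po_nf) (v := ternary_id P)) => [x|s].
  exact: (congr1 (fun u : N => po_of_nterm (sval u)) (po_nf_inl x)).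
apply: (etrans (congr1 (fun u : N => po_of_nterm (sval u)) (po_nf_inr s))).
by apply: (etrans (po_of_glue _)); apply: inr_pi; exact: pi_sectionK.
Qed.

Lemma po_inl_inj : injective inl.
Proof.
by move=> x y /(congr1 po_nf); rewrite !po_nf_inl => /(congr1 sval) [].
Qed.

End PushoutNormalForms.

(** The condition depends on [phi] only through its kernel, which an injection under [B] does not
    change. *)
Lemma extends_kernel_mono (B E E' X Z : ternary_ring) (p : ternary_hom B E)
    (phi : ternary_hom B X) (psi : ternary_hom B Z) (pi : ternary_hom E E')
    (h : X -> Z) : injective h -> (forall b, h (phi b) = psi b) ->
  extends_kernel p phi pi -> extends_kernel p psi pi.
Proof.
move=> h_inj h_arr.
have same b b' : phi b = phi b' <-> psi b = psi b'.
  by rewrite -!h_arr; split=> [->//|/h_inj].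
move=> [surj ker fac]; split=> // [b b'|Y e H]; first by rewrite ker same.
by apply: fac => b b' /same; exact: H.
Qed.

Section PushoutMaps.
Variables (B E X Z : ternary_ring) (p : ternary_hom B E).
Variables (phi : ternary_hom B X) (psi : ternary_hom B Z).

(** The equations determine [k]. A relation takes the place of a construction so that the lemmas
    apply directly to the map produced by [fmap]. *)
Definition is_po_map (h : X -> Z)
    (k : ternary_hom (po_ternary_ring phi p) (po_ternary_ring psi p)) : Prop :=
  (forall x, k (po_homl phi p x) = po_homl psi p (h x)) /\
  (forall s, k (po_homr phi p s) = po_homr psi p s).

Variables (E' : ternary_ring) (pi : ternary_hom E E').
Variables (extX : extends_kernel p phi pi) (extZ : extends_kernel p psi pi).
Variable h : ternary_hom X Z.
Hypotheses (h_inj : injective h) (h_arr : forall b, h (phi b) = psi b).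
Variable k : ternary_hom (po_ternary_ring phi p) (po_ternary_ring psi p).
Hypothesis k_map : is_po_map h k.

(** Both sides come from homomorphisms on the pushout, so it suffices to compare them on the two
    coprojections. On [E] the letter of an element is the same in both amalgams, up to [h] when it
    comes from [B]. *)
Lemma po_nf_map w :
  sval (po_nf extZ (k w)) = nmap h (sval (po_nf extX w)).
Proof.
have [kl kr] := k_map.
pose M := nf_map (extends_ker extX) (extends_ker extZ) h_inj h_arr.
suff e : po_nf extZ (k w) = M (po_nf extX w) by rewrite e.
apply: (po_hom_eq (u := ternary_comp (po_nf extZ) k)
                  (v := ternary_comp M (po_nf extX))) => [x|s].
  rewrite [LHS](congr1 (po_nf extZ) (kl x)) [LHS]po_nf_inl.
  rewrite [RHS](congr1 M (po_nf_inl extX x)).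
  exact: eq_exist.
rewrite [LHS](congr1 (po_nf extZ) (kr s)) [LHS]po_nf_inr.
rewrite [RHS](congr1 M (po_nf_inr extX s)).
apply: eq_exist; rewrite /=; case: (glueP (extends_ker extX)) => [b ->|out] /=.
  by rewrite (glue_rho (extends_ker extZ)) h_arr.
by rewrite glue_out.
Qed.

Lemma po_map_inj : injective k.
Proof.
move=> w w' /(congr1 (fun v => sval (po_nf extZ v))).
rewrite !po_nf_map => /(nmap_inj h_inj) e.
by rewrite -[w](po_nfK extX) e po_nfK.
Qed.

End PushoutMaps.

(** The normal form of [w] has the same image under [nmap f] and [nmap g], so by [nmap_equalizer] it
    comes from a term over [L]. *)
Lemma po_map_equalizer (B E E' L X Z : ternary_ring) (p : ternary_hom B E)
    (lam : ternary_hom B L) (phi : ternary_hom B X) (psi : ternary_hom B Z)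
    (pi : ternary_hom E E') (f g : ternary_hom X Z) (e : ternary_hom L X)
    kf kg ke :
  extends_kernel p phi pi ->
  injective f -> (forall b, f (phi b) = psi b) ->
  injective g -> (forall b, g (phi b) = psi b) ->
  is_po_map (p := p) (phi := phi) (psi := psi) f kf ->
  is_po_map (p := p) (phi := phi) (psi := psi) g kg ->
  is_po_map (p := p) (phi := lam) (psi := phi) e ke ->
  (forall x, f x = g x -> exists l, e l = x) ->
  forall w, kf w = kg w -> exists w', ke w' = w.
Proof.
move=> ext f_inj f_arr g_inj g_arr kfP kgP [kel ker] eqz w kfg.
have extZ := extends_kernel_mono f_inj f_arr ext.
have [u uP] : exists u, nmap e u = sval (po_nf ext w).
  apply: (nmap_equalizer eqz).
  by rewrite -(po_nf_map ext extZ f_inj f_arr kfP) kfg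
             -(po_nf_map ext extZ g_inj g_arr kgP).
(* [u] is a raw term, evaluated in the pushout of [L]. Letters of [E'] are lifted by the same
   section as in [po_of_nterm], so [ke (ev u)] is the value of [nmap e u]. *)
pose fix ev (u : nterm L E') : po_ternary_ring lam p :=
  match u with
  | NX x => po_homl lam p x
  | NE c => po_homr lam p (pi_section ext c)
  | NT u v w => tt3 (ev u) (ev v) (ev w)
  | NQ u v w => tq3 (ev u) (ev v) (ev w)
  end.
exists (ev u); rewrite -[w](po_nfK ext) -uP.
elim: u {uP} => [x|s|u IHu v IHv t IHt|u IHu v IHv t IHt].
- exact: kel.
- exact: ker.
- by rewrite [LHS]th_t IHu IHv IHt.
- by rewrite [LHS]th_q IHu IHv IHt.
Qed.

(* An element of the pushout fixed by the two coprojections is a normal form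
   reduced to a single letter. *)
Lemma po_map_inl (B E E' X : ternary_ring) (p : ternary_hom B E)
    (phi : ternary_hom B X) (pi : ternary_hom E E')
    (P := po_ternary_ring phi p) (inl : ternary_hom X P := po_homl phi p)
    (psi := ternary_comp (po_homr phi p) p)
    (k : ternary_hom P (po_ternary_ring psi p)) :
  extends_kernel p phi pi -> is_po_map inl k ->
  forall w, po_homl psi p w = k w -> exists x, inl x = w.
Proof.
move=> ext kP w kw; have inl_inj := po_inl_inj ext.
have extZ : extends_kernel p psi pi.
  by apply: (extends_kernel_mono inl_inj) ext => b; exact: po_glueE.
have := po_nf_map ext extZ inl_inj (po_glueE phi p) kP w.
rewrite -kw (po_nf_inl extZ).
by case: (sval (po_nf ext w)) => //= x [->]; exists x.
Qed.

(** * Change of cobase and its comparison functor *)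

Definition cs_fun (B : ternary_ring) (X Y : @coslice TernaryRings B)
  (f : hom X Y) : ternary_hom (cs_cod X) (cs_cod Y) := cs_map f.

Lemma cs_fun_arr (B : ternary_ring) (X Y : @coslice TernaryRings B)
  (f : hom X Y) b :
  cs_fun f ((cs_arr X : ternary_hom _ _) b) = (cs_arr Y : ternary_hom _ _) b.
Proof. by rewrite -(cs_map_arr f). Qed.

Lemma cs_fun_eq (B : ternary_ring) (X Y : @coslice TernaryRings B)
  (f g : hom X Y) : cs_fun f =1 cs_fun g -> f = g.
Proof. by move=> fg; apply: coslice_hom_eq; exact: ternary_hom_eq. Qed.

Lemma cs_fun_comp (B : ternary_ring) (X Y Z : @coslice TernaryRings B)
  (g : hom Y Z) (f : hom X Y) x : cs_fun (g ∘ f) x = cs_fun g (cs_fun f x).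
Proof. by []. Qed.

Section Cobase.
Variables (B E : ternary_ring) (p : ternary_hom B E).

Let F := @cobase_functor TernaryRings ternary_pushouts B E p.
Let G := @precomp_functor TernaryRings B E p.
Let adj := @cobase_adjunction TernaryRings ternary_pushouts B E p.

Definition cobase_inl (X : @coslice TernaryRings B) :
  ternary_hom (cs_cod X) (cs_cod (F X)) := po_homl (cs_arr X) p.

Lemma cobase_map_inl (X Y : @coslice TernaryRings B) (f : hom X Y) x :
  cs_fun (fmap F f) (cobase_inl X x) = cobase_inl Y (cs_fun f x).
Proof. exact: (po_eval_class (cobase_map_comm ternary_pushouts p f)). Qed.

Lemma cobase_is_po_map (X Y : @coslice TernaryRings B) (f : hom X Y) :
  is_po_map (p := p) (phi := cs_arr X) (psi := cs_arr Y) (cs_fun f)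
    (cs_fun (fmap F f)).
Proof.
split; first exact: cobase_map_inl.
exact: (cs_fun_arr (fmap F f)).
Qed.

Lemma cobase_counit_inl (Y : @coslice TernaryRings E) y :
  cs_fun (adj_counit adj Y) (cobase_inl (G Y) y) = y.
Proof.
exact: (po_eval_class (@cobase_counit_comm TernaryRings B E p Y) (PoL _ y)).
Qed.

Lemma cobase_hom_eq (X : @coslice TernaryRings B) (Y : @coslice TernaryRings E)
  (u v : hom (F X) Y) :
  (forall x, cs_fun u (cobase_inl X x) = cs_fun v (cobase_inl X x)) -> u = v.
Proof.
move=> uv; apply: cs_fun_eq; apply: po_hom_eq => // s.
by rewrite [LHS](cs_fun_arr u) [RHS](cs_fun_arr v).
Qed.

(** The kernel pair of the coprojection is an object under [B] by the diagonal. Its two projections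
    become equal after pushing out, since maps under [E] out of a pushout are determined on the
    other coprojection. A faithful comparison functor forces the projections themselves to be
    equal. *)
Lemma codescent_inl_inj (X : @coslice TernaryRings B) :
  @effective_codescent TernaryRings ternary_pushouts B E p ->
  injective (cobase_inl X).
Proof.
move=> /equivalence_faithful K_faithful x y inl_xy.
pose A (z : ternary_prod (cs_cod X) (cs_cod X)) :=
  cobase_inl X z.1 = cobase_inl X z.2.
have At u v w : A u -> A v -> A w -> A (tt3 u v w).
  rewrite /A => eu ev ew; rewrite [LHS](th_t (cobase_inl X) u.1 v.1 w.1).
  by rewrite eu ev ew -(th_t (cobase_inl X)).
have Aq u v w : A u -> A v -> A w -> A (tq3 u v w).
  rewrite /A => eu ev ew; rewrite [LHS](th_q (cobase_inl X) u.1 v.1 w.1).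
  by rewrite eu ev ew -(th_q (cobase_inl X)).
have A0 : A tr0 by [].
have A1 : A tr1 by [].
pose T := ternary_sub At Aq A0 A1.
pose f : ternary_hom B (cs_cod X) := cs_arr X.
pose d b : T := exist A (f b, f b) erefl.
have dt b b' b'' : d (tt3 b b' b'') = tt3 (d b) (d b') (d b'').
  by apply: eq_exist; rewrite /= !(th_t f).
have d0 : d tr0 = tr0 by apply: eq_exist; rewrite /= !(th_0 f).
have d1 : d tr1 = tr1 by apply: eq_exist; rewrite /= !(th_1 f).
pose dh : ternary_hom B T := ternary_hom_of_t dt d0 d1.
pose Y : @coslice TernaryRings B := @CosliceOb TernaryRings B T dh.
pose u1 : ternary_hom T (cs_cod X) :=
  ternary_hom_of_t (f := fun z : T => (sval z).1)
    (fun _ _ _ => erefl) erefl erefl.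
pose u2 : ternary_hom T (cs_cod X) :=
  ternary_hom_of_t (f := fun z : T => (sval z).2)
    (fun _ _ _ => erefl) erefl erefl.
have u1_arr : ternary_comp u1 dh = f by exact: ternary_hom_eq.
have u2_arr : ternary_comp u2 dh = f by exact: ternary_hom_eq.
pose v1 : hom Y X := @CosliceHom TernaryRings B Y X u1 u1_arr.
pose v2 : hom Y X := @CosliceHom TernaryRings B Y X u2 u2_arr.
have v12 : v1 = v2.
  apply: K_faithful; apply: coalgebra_hom_eq.
  apply: (@cobase_hom_eq Y (F X)) => z.
  by rewrite [LHS]cobase_map_inl [RHS]cobase_map_inl; exact: (svalP z).
pose z : T := exist A (x, y) inl_xy.
exact: (congr1 (fun v : hom Y X => cs_fun v z) v12).
Qed.

Section CongruenceExtension.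
Hypothesis p_ext : forall (X : ternary_ring) (phi : ternary_hom B X),
  exists (E' : ternary_ring) (pi : ternary_hom E E'), extends_kernel p phi pi.

Lemma cobase_inl_inj X : injective (cobase_inl X).
Proof. by have [E' [pi /po_inl_inj]] := p_ext (cs_arr X). Qed.

Lemma cobase_map_inj (X Z : @coslice TernaryRings B) (f : hom X Z) :
  injective (cs_fun f) -> injective (cs_fun (fmap F f)).
Proof.
move=> f_inj; have [E' [pi ext]] := p_ext (cs_arr X).
have extZ := extends_kernel_mono f_inj (cs_fun_arr f) ext.
exact: (po_map_inj ext extZ f_inj (cs_fun_arr f) (cobase_is_po_map f)).
Qed.

Lemma cobase_equalizer (L X Z : @coslice TernaryRings B) (f g : hom X Z)
    (e : hom L X) : injective (cs_fun f) -> injective (cs_fun g) ->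
  (forall x, cs_fun f x = cs_fun g x -> exists l, cs_fun e l = x) ->
  forall w, cs_fun (fmap F f) w = cs_fun (fmap F g) w ->
    exists w', cs_fun (fmap F e) w' = w.
Proof.
move=> f_inj g_inj eqz; have [E' [pi ext]] := p_ext (cs_arr X).
exact: (po_map_equalizer ext f_inj (cs_fun_arr f) g_inj (cs_fun_arr g)
  (cobase_is_po_map f) (cobase_is_po_map g) (cobase_is_po_map e) eqz).
Qed.

Lemma cobase_inl_descent (X : @coslice TernaryRings B) (w : cs_cod (F X)) :
  cobase_inl (G (F X)) w = cs_fun (fmap F (adj_unit adj X)) w ->
  exists x, cobase_inl X x = w.
Proof.
have [E' [pi ext]] := p_ext (cs_arr X).
exact: (po_map_inl ext (cobase_is_po_map (adj_unit adj X))).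
Qed.

Let K := comparison adj.

Lemma comparison_faithful (X Z : @coslice TernaryRings B) (f g : hom X Z) :
  fmap K f = fmap K g -> f = g.
Proof.
move=> /(congr1 (fun h => coalg_map h)) fg; apply: cs_fun_eq => x.
apply: cobase_inl_inj; rewrite -!cobase_map_inl.
exact: (congr1 (fun h : hom (F X) (F Z) => cs_fun h (cobase_inl X x)) fg).
Qed.

(** Compatibility with the structure maps gives the hypothesis of [cobase_inl_descent] at the image
    of each [x], so [h] restricts to a map from [X] to [Z]. Injectivity of the coprojection makes
    the restriction a homomorphism. *)
Lemma comparison_full (X Z : @coslice TernaryRings B) (g : hom (K X) (K Z)) :
  exists f, fmap K f = g.
Proof.
pose h : hom (F X) (F Z) := coalg_map g.
have h_ex x : exists z, cobase_inl Z z = cs_fun h (cobase_inl X x).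
  apply: cobase_inl_descent.
  have e := congr1 (fun k => cs_fun k (cobase_inl X x)) (coalg_map_str g).
  apply/esym/(etrans e).
  apply: (etrans (congr1 (cs_fun (fmap F (fmap G h)))
                         (cobase_map_inl (adj_unit adj X) x))).
  exact: (cobase_map_inl (fmap G h)).
pose f x := projT1 (cid (h_ex x)).
have fP x : cobase_inl Z (f x) = cs_fun h (cobase_inl X x).
  exact: projT2 (cid (h_ex x)).
have ft x y z : f (tt3 x y z) = tt3 (f x) (f y) (f z).
  by apply: cobase_inl_inj; rewrite th_t !fP !th_t.
have f0 : f tr0 = tr0 by apply: cobase_inl_inj; rewrite fP !th_0.
have f1 : f tr1 = tr1 by apply: cobase_inl_inj; rewrite fP !th_1.
pose fh : ternary_hom (cs_cod X) (cs_cod Z) := ternary_hom_of_t ft f0 f1.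
have f_arr : ternary_comp fh (cs_arr X) = cs_arr Z.
  apply: ternary_hom_eq => b; apply: cobase_inl_inj; rewrite [LHS]fP.
  rewrite [RHS](po_glueE (cs_arr Z)) [X in cs_fun h X = _](po_glueE (cs_arr X)).
  exact: (cs_fun_arr h).
exists (@CosliceHom TernaryRings B X Z fh f_arr).
apply: coalgebra_hom_eq; apply: (@cobase_hom_eq X (F Z)) => x.
by rewrite [LHS]cobase_map_inl [LHS]fP.
Qed.

(** The preimage [L] of the coalgebra is the equalizer of the structure map [th] and the
    coprojection. The isomorphism [m] is the adjoint transpose of its inclusion. *)
Lemma comparison_eso (Y : coalgebras (adj_comonad adj)) :
  exists (X : @coslice TernaryRings B) (f : hom (K X) Y), is_iso f.
Proof.
pose A := coalg_ob Y; pose th : hom A (F (G A)) := coalg_str Y.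
pose inlA := cobase_inl (G A).
have counit_th y : cs_fun (adj_counit adj A) (cs_fun th y) = y.
  exact: (congr1 (fun k => cs_fun k y) (coalg_counit Y)).
pose D y := cs_fun th y = inlA y.
have Dt x y z : D x -> D y -> D z -> D (tt3 x y z).
  by rewrite /D !th_t => -> -> ->.
have Dq x y z : D x -> D y -> D z -> D (tq3 x y z).
  by rewrite /D !th_q => -> -> ->.
have D0 : D tr0 by rewrite /D !th_0.
have D1 : D tr1 by rewrite /D !th_1.
pose L := ternary_sub Dt Dq D0 D1.
pose a : ternary_hom B (cs_cod A) := cs_arr (G A).
have aD b : D (a b).
  rewrite /D [RHS](po_glueE a); exact: (cs_fun_arr th).
pose l b : L := exist D (a b) (aD b).
have lt b b' b'' : l (tt3 b b' b'') = tt3 (l b) (l b') (l b'').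
  by apply: eq_exist; exact: (th_t a).
have l0 : l tr0 = tr0 by apply: eq_exist; exact: (th_0 a).
have l1 : l tr1 = tr1 by apply: eq_exist; exact: (th_1 a).
pose lh : ternary_hom B L := ternary_hom_of_t lt l0 l1.
pose X : @coslice TernaryRings B := @CosliceOb TernaryRings B L lh.
pose iota : ternary_hom L (cs_cod A) := ternary_incl Dt Dq D0 D1.
have iota_arr : ternary_comp iota lh = a by exact: ternary_hom_eq.
pose e : hom X (G A) := @CosliceHom TernaryRings B X (G A) iota iota_arr.
have e_inj : injective (cs_fun e).
  by move=> [x Dx] [y Dy] /= xy; exact: eq_exist.
pose m : hom (F X) A := adj_counit adj A ∘ fmap F e.
have m_inl x : cs_fun m (cobase_inl X x) = cs_fun e x.
  rewrite /m cs_fun_comp cobase_map_inl; exact: cobase_counit_inl.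
(* On [L] the structure map is the coprojection. Injectivity of [m] will follow from that of
   [fmap F e]. *)
have th_m : th ∘ m = fmap F e.
  apply: cobase_hom_eq => x; rewrite cs_fun_comp m_inl cobase_map_inl.
  exact: (svalP x).
have m_str : th ∘ m = fmap F (fmap G m) ∘ fmap F (adj_unit adj X).
  rewrite th_m; apply: cobase_hom_eq => x.
  by rewrite cs_fun_comp !cobase_map_inl [X in _ = _ X]m_inl.
pose mK : hom (K X) Y := @CoalgebraHom _ (adj_comonad adj) (K X) Y m m_str.
exists X, mK; apply: coalgebra_iso; apply: coslice_iso.
apply: (@ternary_bij_iso _ _ (cs_fun m)).
  move=> w w' /(congr1 (cs_fun th)); rewrite -!cs_fun_comp th_m.
  exact: cobase_map_inj.
move=> y; have th_inj : injective (cs_fun th).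
  by move=> x x' /(congr1 (cs_fun (adj_counit adj A))); rewrite !counit_th.
(* Coassociativity says that [th y] is equalized by the images under [F] of the unit and of [th]. As
   pushing out preserves this equalizer, [th y] comes from the pushout of [L]. *)
have [w wE] : exists w, cs_fun (fmap F e) w = cs_fun th y.
  apply: (@cobase_equalizer X (G A) (G (F (G A)))
    (adj_unit adj (G A)) (fmap G th)) => //.
  - exact: cobase_inl_inj.
  - by move=> x Dx; exists (exist D x (esym Dx)).
  - exact: (congr1 (fun k => cs_fun k y) (coalg_coassoc Y)).
by exists w; rewrite /m cs_fun_comp wE counit_th.
Qed.

Lemma congruence_extension_codescent :
  @effective_codescent TernaryRings ternary_pushouts B E p.
Proof.
exact: full_faithful_eso_equivalence comparison_full comparison_faithful
  comparison_eso.
Qed.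

End CongruenceExtension.
End Cobase.

(** * Ideals as kernels, and the equivalence with ideal extension *)

Section RingKernels.
Variables (R : comPzRingType) (T : ternary_ring).
Variable f : ternary_hom (ternary_of_ring R) T.

(** Differences are expressible in ternary terms: [x - y = q(1,y,x)] and [x = t(1,y,x - y)], while
    [q(1,z,z) = 0] in every ternary ring. *)
Lemma ternary_kerP (x y : R) : f x = f y <-> f (x - y) = tr0.
Proof.
split=> [e|e].
  have := th_q f (1 : R) y x; rewrite /= mul1r => ->.
  by rewrite e (th_1 f) tq3_1l.
have := th_t f (1 : R) y (x - y); rewrite /= mul1r addrC subrK => ->.
by rewrite e (th_1 f) tt3_1l.
Qed.

(** Sums are [t(1,x,y)] and multiples are [t(a,x,0)]. *)
Lemma ternary_ker_ideal : is_ideal (fun x : R => f x = tr0).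
Proof.
split=> [|x y fx fy|a x fx]; first exact: (th_0 f).
  have := th_t f (1 : R) x y; rewrite /= mul1r => ->.
  by rewrite fx fy tt3_0r.
have := th_t f a x (0 : R); rewrite /= addr0 => ->.
by rewrite fx tt3_0r (th_0 f).
Qed.

End RingKernels.

Theorem lemma4p2 (R S : comPzRingType) (p : {rmorphism R -> S})
    (p_inj : injective p) :
  effective_codescent ternary_pushouts (ternary_of_rmorphism p) <->
  ideal_extension_property p.
Proof.
pose q : ternary_hom (ternary_of_ring R) (ternary_of_ring S) :=
  ternary_of_rmorphism p.
split=> [codesc I I_ideal|iep].
  have [Q [pi [pi_surj piP]]] := ideal_quotient I_ideal.
  have piI x : pi x = tr0 <-> I x.
    by rewrite -(th_0 pi) (piP x 0) subr0.
  pose X : @coslice TernaryRings (ternary_of_ring R) :=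
    @CosliceOb TernaryRings _ Q pi.
  have inl_inj : injective (po_homl pi q) := codescent_inl_inj (X := X) codesc.
  (* This kernel pulls back to [I] because the coprojection from [R/I] is injective and agrees with
     the one from [S] on [R]. *)
  exists (fun s : S => po_homr pi q s = tr0); split.
    exact: ternary_ker_ideal.
  apply: funext => x; apply: propext; rewrite -piI.
  have inlE : po_homl pi q (pi x) = po_homr pi q (p x) := po_glueE pi q x.
  have inl0 := th_0 (po_homl pi q).
  split=> [inr0|pi0].
    exact/inl_inj/(etrans inlE)/(etrans inr0)/esym.
  exact: etrans (esym inlE) (etrans (congr1 _ pi0) inl0).
apply: (@congruence_extension_codescent _ _ q) => X phi.
pose I (x : R) := phi x = tr0.
have [I' [[I'0 I'D I'M] I'E]] := iep I (ternary_ker_ideal phi).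
(* [J] is the ideal generated by the image of [I]. It lies in [I'], hence also pulls back to [I],
   and being the smallest it gives the universal property required by [extends_kernel]. *)
pose J (s : S) :=
  forall K : set S, is_ideal K -> (forall x, I x -> K (p x)) -> K s.
have J_ideal : is_ideal J.
  split=> [K [] //|s s' Js Js' K KI pK|a s Js K KI pK].
    by have [_ KD _] := KI; apply: KD; [exact: Js|exact: Js'].
  by have [_ _ KM] := KI; apply: KM; exact: Js.
have JI x : J (p x) <-> I x.
  split=> [Jx|Ix K _]; last exact.
  by rewrite -I'E; apply: Jx => // y; rewrite -I'E.
have [Q [pi [pi_surj piP]]] := ideal_quotient J_ideal.
exists Q, pi; split=> // [b b'|Y e ephi s s'].
  by rewrite [X in X <-> _]piP /= -rmorphB JI ternary_kerP.
move=> /piP Jss; apply/ternary_kerP.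
(* The kernel of [e] is an ideal containing the image of [I], so it contains [J]. *)
apply: (Jss (fun s : S => e s = tr0)) => [|x Ix].
  exact: ternary_ker_ideal.
rewrite -(th_0 e) -(th_0 q); apply: ephi.
by rewrite (th_0 phi).
Qed.
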